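(* Let $(\mathcal M,g)$ be a 4-dimensional manifold with a (complex-valued, or real of any signature) metric $g$ and let $(e_1,e_2,e_3,e_4)=(m,p,n,k)$ be a null frame. (1) Suppose that in this frame $\mathsf P_{11}\equiv\mathsf P_{14}\equiv\mathsf P_{44}\equiv 0$ and $\kappa\equiv\sigma\equiv 0$. Then $\Psi_0\equiv\Psi_1\equiv 0$. (2) If $g$ is Einstein, $Ric(g)=\Lambda g$, and has a nowhere vanishing selfdual part of the Weyl tensor, then $\Psi_0\equiv\Psi_1\equiv 0$ implies $\kappa\equiv\sigma\equiv 0$.
   Context: $\mathcal M$ is a real 4-manifold with a smooth complex-valued metric $g$ (a nondegenerate symmetric complex bilinear form on ${\rm T}^{\mathbb C}\mathcal M$; real metrics of any signature are included by complex bilinear extension), or a complex 4-manifold with a holomorphic metric. A null frame $(e_1,e_2,e_3,e_4)=(m,p,n,k)$ is a (local) frame with $g(m,p)=g(n,k)=1$ and all other products of frame vectors zero; the orientation is such that ${\rm Span}_{\mathbb C}(m,k)$ is a selfdual plane. $(\theta^a)$ is the dual coframe. Levi-Civita connection coefficients: $\nabla_{e_c}e_b=\Gamma^a{}_{bc}e_a$, $\Gamma_{abc}=g_{ad}\Gamma^d{}_{bc}=-\Gamma_{bac}$; $\sigma=\Gamma_{141}$, $\kappa=\Gamma_{144}$ (these vanish identically iff ${\rm Span}_{\mathbb C}(m,k)$ is an integrable distribution). Curvature: $R(e_c,e_d)e_b=R^a{}_{bcd}e_a$, $R_{ab}=R^c{}_{acb}$ is the Ricci tensor, $R=g^{ab}R_{ab}$,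 $\mathsf P_{ab}=\tfrac12R_{ab}-\tfrac1{12}Rg_{ab}$ is the Schouten tensor, and $C_{abcd}=R_{abcd}+g_{ad}\mathsf P_{cb}-g_{ac}\mathsf P_{db}+g_{bc}\mathsf P_{da}-g_{bd}\mathsf P_{ca}$ is the Weyl tensor. The selfdual part of the Weyl tensor has components $\Psi_0=C(m,k,m,k)$, $\Psi_1=C(m,k,n,k)$, $\Psi_2=C(m,k,p,n)$, $\Psi_3=C(p,n,m,p)$, $\Psi_4=C(p,n,p,n)$; it vanishes at a point iff all five vanish there. *)

(* Defs.v *)
From HB Require Import structures.
From mathcomp Require Import all_boot all_order all_algebra.
From mathcomp Require Import complex.
From mathcomp Require Import all_classical all_reals all_analysis.
Set Implicit Arguments.
Unset Strict Implicit.
Unset Printing Implicit Defensive.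
Import Order.TTheory GRing.Theory Num.Theory.
Import numFieldNormedType.Exports.

Local Open Scope classical_set_scope.
Local Open Scope ring_scope.

(* Real manifolds with complex-valued tensors and complex manifolds with
   holomorphic tensors are treated uniformly: the charts take values in K^4,
   where K is R or C, and every function and tensor component is C-valued. *)
Inductive ground := RealGround | ComplexGround.

Definition Cplx (R : realType) : numFieldType := (R[i] : numFieldType).

Definition scalar (R : realType) (b : ground) : numFieldType :=
  match b with
  | RealGround => (R : numFieldType)
  | ComplexGround => Cplx R
  end.

Definition embed (R : realType) (b : ground) : scalar R b -> Cplx R :=
  match b return scalar R b -> Cplx R with
  | RealGround => fun x : R => Complex x 0
  | ComplexGround => fun z => z
  end.
Arguments embed {R b} _.

Section Calculus.
Variables (R : realType) (b : ground).
Local Notation K := (scalar R b).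
Local Notation C := (Cplx R).

Definition diff_quot (F : 'rV[K]_4 -> C) (x : 'rV[K]_4) (mu : 'I_4) : K -> C :=
  fun h => (embed h)^-1 * (F (x + h *: delta_mx 0 mu) - F x).

(* The partial derivative with respect to the mu-th K-coordinate; for
   K = C this is the complex derivative. *)
Definition partial (mu : 'I_4) (F : 'rV[K]_4 -> C) (x : 'rV[K]_4) : C :=
  lim (diff_quot F x mu h @[h --> (0 : K)^']).

Fixpoint Cn (n : nat) (W : set 'rV[K]_4) (F : 'rV[K]_4 -> C) : Prop :=
  (forall x, W x -> {for x, continuous F}) /\
  if n is n'.+1 then
    forall mu, (forall x, W x -> cvg (diff_quot F x mu h @[h --> (0 : K)^']))
               /\ Cn n' W (partial mu F)
  else True.

(* To be used on open sets W. For K = R this is C^oo; for K = C it is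
   infinite complex differentiability, that is, holomorphy. *)
Definition smooth_coord (W : set 'rV[K]_4) (F : 'rV[K]_4 -> C) : Prop :=
  forall n, Cn n W F.

Record chart (M : topologicalType) := Chart {
  chart_dom : set M;
  chart_map :> M -> 'rV[K]_4;
  chart_inv : 'rV[K]_4 -> M;
  chart_dom_open : open chart_dom;
  chart_img_open : open (chart_map @` chart_dom);
  chart_mapK : forall p, chart_dom p -> chart_inv (chart_map p) = p;
  chart_map_cont : forall p, chart_dom p -> {for p, continuous chart_map};
  chart_inv_cont : forall x, (chart_map @` chart_dom) x ->
    {for x, continuous chart_inv}
}.

(* [chart_at] selects a chart of the atlas around each point; it only serves
   to identify the tangent spaces with C^4. *)
Record manifold4 := Manifold4 {
  carrier :> topologicalType;
  manifold_hausdorff : hausdorff_space carrier;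
  manifold_second_countable : @second_countable carrier;
  atlas : set (chart carrier);
  chart_at : carrier -> chart carrier;
  chart_at_atlas : forall p, atlas (chart_at p);
  chart_at_dom : forall p, chart_dom (chart_at p) p;
  atlas_compatible : forall phi psi, atlas phi -> atlas psi -> forall mu,
    smooth_coord (phi @` (chart_dom phi `&` chart_dom psi))
      (fun x => embed (psi (chart_inv phi x) 0 mu))
}.

End Calculus.

Section Tensors.
Variables (R : realType) (b : ground) (M : manifold4 R b).
Local Notation C := (Cplx R).

Definition smooth (V : set M) (f : M -> C) : Prop :=
  forall phi, @atlas R b M phi ->
    smooth_coord (phi @` (V `&` chart_dom phi)) (f \o chart_inv phi).

(* The tangent space at p is the complexified one for K = R and the
   holomorphic one for K = C. In both cases it is identified with C^4 by the
   coordinate basis of the chart [chart_at p]. *)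
Definition vfield : Type := M -> 'rV[C]_4.

Definition act (X : vfield) (f : M -> C) : M -> C := fun p =>
  \sum_(mu < 4) X p 0 mu *
    partial mu (f \o chart_inv (chart_at p)) (chart_at p p).

Definition smooth_field (V : set M) (X : vfield) : Prop :=
  forall W, open W -> W `<=` V ->
    forall f, smooth W f -> smooth W (act X f).

(* The vector of [X, Y] at p is the derivation f |-> X (Y f) - Y (X f); its
   components are obtained by applying it to the coordinates of
   [chart_at p]. *)
Definition lie_bracket (X Y : vfield) : vfield := fun p =>
  \row_mu (let x_mu := fun q => embed (chart_at p q 0 mu) : C in
           act X (act Y x_mu) p - act Y (act X x_mu) p).

Definition ip (g : M -> 'M[C]_4) (X Y : vfield) : M -> C :=
  fun p => (X p *m g p *m (Y p)^T) 0 0.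

Record is_metric (g : M -> 'M[C]_4) : Prop := IsMetric {
  metric_sym : forall p, (g p)^T = g p;
  metric_nondeg : forall p, g p \in unitmx;
  metric_smooth : forall V, open V -> forall X Y,
    smooth_field V X -> smooth_field V Y -> smooth V (ip g X Y)
}.

(* The connection is given on local vector fields. A field on V is represented
   by a function on M whose values outside V are irrelevant, hence the locality
   axiom. *)
Record is_levi_civita (g : M -> 'M[C]_4) (nabla : vfield -> vfield -> vfield) :
    Prop := IsLeviCivita {
  nabla_smooth : forall V, open V -> forall X Y,
    smooth_field V X -> smooth_field V Y -> smooth_field V (nabla X Y);
  nabla_local : forall V, open V -> forall X X' Y Y',
    smooth_field V X -> smooth_field V Y ->
    (forall p, V p -> X p = X' p) -> (forall p, V p -> Y p = Y' p) ->
    forall p, V p -> nabla X Y p = nabla X' Y' p;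
  nabla_addl : forall V, open V -> forall X X' Y,
    smooth_field V X -> smooth_field V X' -> smooth_field V Y ->
    forall p, V p ->
    nabla (fun q => X q + X' q) Y p = nabla X Y p + nabla X' Y p;
  nabla_scalel : forall V, open V -> forall f X Y,
    smooth V f -> smooth_field V X -> smooth_field V Y ->
    forall p, V p -> nabla (fun q => f q *: X q) Y p = f p *: nabla X Y p;
  nabla_addr : forall V, open V -> forall X Y Y',
    smooth_field V X -> smooth_field V Y -> smooth_field V Y' ->
    forall p, V p ->
    nabla X (fun q => Y q + Y' q) p = nabla X Y p + nabla X Y' p;
  nabla_leibniz : forall V, open V -> forall f X Y,
    smooth V f -> smooth_field V X -> smooth_field V Y ->
    forall p, V p ->
    nabla X (fun q => f q *: Y q) p = act X f p *: Y p + f p *: nabla X Y p;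
  (* nabla_X Y - nabla_Y X = [X, Y], as derivations of the local functions *)
  nabla_torsion_free : forall V, open V -> forall X Y f,
    smooth_field V X -> smooth_field V Y -> smooth V f ->
    forall p, V p ->
    act (fun q => nabla X Y q - nabla Y X q) f p
      = act X (act Y f) p - act Y (act X f) p;
  nabla_metric : forall V, open V -> forall X Y Z,
    smooth_field V X -> smooth_field V Y -> smooth_field V Z ->
    forall p, V p ->
    act X (ip g Y Z) p = ip g (nabla X Y) Z p + ip g Y (nabla X Z) p
}.

Definition curvature (nabla : vfield -> vfield -> vfield) (X Y Z : vfield) : vfield :=
  fun p => nabla X (nabla Y Z) p - nabla Y (nabla X Z) p
           - nabla (lie_bracket X Y) Z p.

Definition i1 : 'I_4 := @Ordinal 4 0 isT.
Definition i2 : 'I_4 := @Ordinal 4 1 isT.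
Definition i3 : 'I_4 := @Ordinal 4 2 isT.
Definition i4 : 'I_4 := @Ordinal 4 3 isT.

(* The frame is (e i1, e i2, e i3, e i4) = (m, p, n, k). The tangent spaces
   have dimension 4, so the values of the products force the four vectors to
   form a basis. *)
Definition null_frame (g : M -> 'M[C]_4) (U : set M) (e : 'I_4 -> vfield) : Prop :=
  (forall a, smooth_field U (e a)) /\
  forall q, U q -> forall a c,
    ip g (e a) (e c) q
      = ((a, c) \in [:: (i1, i2); (i2, i1); (i3, i4); (i4, i3)])%:R.

Section FrameComponents.
Variables (g : M -> 'M[C]_4) (nabla : vfield -> vfield -> vfield).
Variable e : 'I_4 -> vfield.

(* v = \sum_a coframe a q v *: e a q *)
Definition coframe (a : 'I_4) (q : M) (v : 'rV[C]_4) : C :=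
  (v *m invmx (\matrix_(c < 4) e c q)) 0 a.

Definition gmx (q : M) : 'M[C]_4 := \matrix_(a < 4, c < 4) ip g (e a) (e c) q.

(* Gamma_up a b c = Gamma^a_{bc} and Gamma a b c = Gamma_{abc} *)
Definition Gamma_up (a b c : 'I_4) (q : M) : C :=
  coframe a q (nabla (e c) (e b) q).
Definition Gamma (a b c : 'I_4) (q : M) : C :=
  \sum_(d < 4) gmx q a d * Gamma_up d b c q.

Definition sigma : M -> C := Gamma i1 i4 i1.
Definition kappa : M -> C := Gamma i1 i4 i4.

(* Riem_up a b c d = R^a_{bcd} and Riem a b c d = R_{abcd} *)
Definition Riem_up (a b c d : 'I_4) (q : M) : C :=
  coframe a q (curvature nabla (e c) (e d) (e b) q).
Definition Riem (a b c d : 'I_4) (q : M) : C :=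
  \sum_(f < 4) gmx q a f * Riem_up f b c d q.

Definition Ric (a b : 'I_4) (q : M) : C := \sum_(c < 4) Riem_up c a c b q.
Definition Rscal (q : M) : C :=
  \sum_(a < 4) \sum_(c < 4) invmx (gmx q) a c * Ric a c q.
Definition Schouten (a b : 'I_4) (q : M) : C :=
  2%:R^-1 * Ric a b q - 12%:R^-1 * Rscal q * gmx q a b.
Definition Weyl (a b c d : 'I_4) (q : M) : C :=
  Riem a b c d q
  + gmx q a d * Schouten c b q - gmx q a c * Schouten d b q
  + gmx q b c * Schouten d a q - gmx q b d * Schouten c a q.

Definition Psi0 : M -> C := Weyl i1 i4 i1 i4.
Definition Psi1 : M -> C := Weyl i1 i4 i3 i4.
Definition Psi2 : M -> C := Weyl i1 i4 i2 i3.
Definition Psi3 : M -> C := Weyl i2 i3 i1 i2.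
Definition Psi4 : M -> C := Weyl i2 i3 i2 i3.

Definition sd_weyl_vanishes_at (q : M) : Prop :=
  [/\ Psi0 q = 0, Psi1 q = 0, Psi2 q = 0, Psi3 q = 0 & Psi4 q = 0].

Definition einstein_on (U : set M) (Lambda : C) : Prop :=
  forall q, U q -> forall a c, Ric a c q = Lambda * gmx q a c.

End FrameComponents.

End Tensors.

(* Main.v *)
Require Import Defs.
From HB Require Import structures.
From mathcomp Require Import all_boot all_order all_algebra.
From mathcomp Require Import all_classical all_reals all_analysis.
From mathcomp Require Import complex ring.
Set Implicit Arguments.
Unset Strict Implicit.
Unset Printing Implicit Defensive.
Import Order.TTheory GRing.Theory Num.Theory.
Import numFieldNormedType.Exports.
Local Open Scope classical_set_scope.
Local Open Scope ring_scope.

(* The selfdual part of the connection is given by the 1-forms A_c = Gamma_{14c},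
   B_c = Gamma_{34c} - Gamma_{12c} and C_c = Gamma_{23c}. Its curvature
   F = dA + A /\ B, G = dB + 2 A /\ C, H = dC + B /\ C satisfies the Bianchi
   identities dF = F /\ B - A /\ G and dG = 2 (F /\ C - A /\ H). Here
   sigma = A_1, kappa = A_4, and F_14, F_34, F_23, H_12, H_23 are, up to Ricci
   terms, Psi0, Psi1, Psi2, Psi3, Psi4.

   (1) If A_1 = A_4 = 0 then F_14 = 0 by the structure equation, and the
   vanishing Ricci components give F_13 = F_24 = 0 and F_12 = - F_34. With
   psi = F_34 the Bianchi identities on (e1, e3, e4) and (e1, e2, e4) become
   D_1 psi = (B_1 + 4 A_3) psi and D_4 psi = (B_4 - 4 A_2) psi; comparing
   [D_1, D_4] psi with the structure equations gives 10 psi^2 = 0.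

   (2) If A_i (i = 1 or 4) is nonzero at a point, it is nonzero on a
   neighbourhood W. In the Einstein case the Bianchi identities on (e1, e2, e4)
   and (e1, e3, e4) give A_i Psi2 = 0, hence Psi2 = 0 on W; then those on
   (e2, e3, e4) and (e1, e2, e3) give A_i Psi3 = 0 and, once Psi3 = 0 on W,
   A_i Psi4 = 0, so that the selfdual Weyl tensor vanishes at the point. *)

(** * Partial derivatives *)

Section PartialDerivatives.
Variables (R : realType) (b : ground).
Local Notation K := (Defs.scalar R b).
Local Notation C := (Cplx R).
Local Notation pt := 'rV[K]_4.
Local Notation emb := (@embed R b).
Implicit Types (F G : pt -> C) (W : set pt) (x : pt) (mu : 'I_4).

Lemma embed_eq0 (h : K) : (emb h == 0) = (h == 0).
Proof. by move: h; case: b => h //=; rewrite eq_complex /= eqxx andbT. Qed.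

Lemma embedB (h k : K) : emb (h - k) = embed h - embed k.
Proof.
move: h k; case: b => h k //=.
by apply/eqP; rewrite eq_complex /= subr0 !eqxx.
Qed.

Local Instance nbhs0_filter : Filter (nbhs (0 : K)) := nbhs_filter _.
Local Instance dnbhs0_filter : @Filter K (0 : K)^' := dnbhs_filter _.

Lemma line_cvg x mu : (x + h *: delta_mx 0 mu) @[h --> (0 : K)^'] --> x.
Proof.
apply: cvg_within_filter.
have : x + h *: delta_mx 0 mu @[h --> (0 : K)] --> x + 0 *: delta_mx 0 mu.
  apply: (@cvgD _ (pt : normedModType K)); first exact: cvg_cst.
  by apply: (@cvgZr_tmp _ (pt : normedModType K)); exact: cvg_id.
by rewrite scale0r addr0.
Qed.

(** The two image filters are equal, not only their limits, so both the existence and the value of a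
    partial derivative are local. *)
Lemma diff_quot_eq_lim F G x mu : (\forall y \near x, F y = G y) ->
  diff_quot F x mu h @[h --> (0 : K)^'] = diff_quot G x mu h @[h --> (0 : K)^'].
Proof.
move=> FG; have FGx := nbhs_singleton FG.
have H : \forall h \near (0 : K)^', diff_quot F x mu h = diff_quot G x mu h.
  have FGh : \forall h \near (0 : K)^',
      F (x + h *: delta_mx 0 mu) = G (x + h *: delta_mx 0 mu).
    exact: (@line_cvg x mu _ FG).
  by apply: filterS FGh => h /= e; rewrite /diff_quot e FGx.
apply/funext => A; apply/propext; split=> HA.
- by apply: filterS2 H HA => h /= ->.
- by apply: filterS2 H HA => h /= ->.
Qed.

Lemma partial_local F G x mu : (\forall y \near x, F y = G y) ->
  partial mu F x = partial mu G x.
Proof. by move=> FG; rewrite /partial (diff_quot_eq_lim mu FG). Qed.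

(** * Limits of difference quotients *)

Definition tends (u : K -> C) (l : C) : Prop := u h @[h --> (0 : K)^'] --> l.

Lemma tends_eq (u v : K -> C) (l : C) :
  tends u l -> (\forall h \near (0 : K)^', u h = v h) -> tends v l.
Proof.
by move=> ul uv; apply: (cvg_trans _ ul); exact: near_eq_cvg.
Qed.

Lemma tendsD u v (l m : C) :
  tends u l -> tends v m -> tends (fun h => u h + v h) (l + m).
Proof. by move=> ul vm; exact: (cvgD ul vm). Qed.

Lemma tendsM u v (l m : C) :
  tends u l -> tends v m -> tends (fun h => u h * v h) (l * m).
Proof. by move=> ul vm; exact: (cvgM ul vm). Qed.

Lemma tends_cst (l : C) : tends (fun=> l) l.
Proof. exact: cvg_cst. Qed.

Lemma partial_cvgP mu F x : cvg (diff_quot F x mu h @[h --> (0 : K)^']) <->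
  exists l, tends (diff_quot F x mu) l.
Proof. exact: cvg_ex. Qed.

Lemma partial_tends mu F x : cvg (diff_quot F x mu h @[h --> (0 : K)^']) ->
  tends (diff_quot F x mu) (partial mu F x).
Proof. by []. Qed.

Lemma partial_unique mu F x l :
  tends (diff_quot F x mu) l -> partial mu F x = l.
Proof.
by move=> H; apply: (@cvg_lim _ _ _ _ (Proper_dnbhs_numFieldType (0 : K)) _ _ H).
Qed.

Lemma tends_diff_quotD F G x mu (l m : C) :
  tends (diff_quot F x mu) l -> tends (diff_quot G x mu) m ->
  tends (diff_quot (F \+ G) x mu) (l + m).
Proof.
move=> Fl Gm; apply: (tends_eq (tendsD Fl Gm)); apply: nearW => h.
by rewrite /diff_quot /=; ring.
Qed.

(** The quotient of $FG$ splits as the quotient of $F$ times $G(x+h\,\delta_\mu)$ plus $F(x)$ times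
    the quotient of $G$; continuity of $G$ handles the shifted factor. *)
Lemma tends_diff_quotM F G x mu (l m : C) : {for x, continuous G} ->
  tends (diff_quot F x mu) l -> tends (diff_quot G x mu) m ->
  tends (diff_quot (F \* G) x mu) (l * G x + F x * m).
Proof.
move=> cG Fl Gm.
have cG' : tends (fun h => G (x + h *: delta_mx 0 mu)) (G x).
  exact: cvg_comp (@line_cvg x mu) cG.
apply: (tends_eq (tendsD (tendsM Fl cG') (tendsM (@tends_cst (F x)) Gm))).
by apply: nearW => h; rewrite /diff_quot /=; ring.
Qed.

Lemma tends_diff_quot_cst (c : C) x mu : tends (diff_quot (fun=> c) x mu) 0.
Proof.
apply: (tends_eq (@tends_cst 0)); apply: nearW => h.
by rewrite /diff_quot subrr mulr0.
Qed.

Lemma partial_cst (c : C) x mu : partial mu (fun=> c) x = 0.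
Proof. exact/partial_unique/tends_diff_quot_cst. Qed.

Lemma partial_coord x mu nu :
  partial mu (fun y : pt => emb (y 0 nu)) x = (mu == nu)%:R.
Proof.
apply: partial_unique; apply: (tends_eq (@tends_cst _)).
have : \forall h \near (0 : K)^', h != 0 by exact: nbhs_dnbhs_neq.
apply: filterS => h h0.
rewrite /diff_quot -embedB !mxE eqxx /= [x 0 nu + _]addrC addrK eq_sym.
case: (nu == mu); last first.
  rewrite mulr0; have /eqP -> : emb (0 : K) == 0 by rewrite embed_eq0.
  by rewrite mulr0.
by rewrite mulr1 mulVf // embed_eq0.
Qed.

(** * Continuity and closure properties of [Cn] *)

Lemma near_open W x (P : pt -> Prop) : open W -> W x ->
  (forall y, W y -> P y) -> \forall y \near x, P y.
Proof. by move=> oW Wx WP; apply: filterS (open_nbhs_nbhs (conj oW Wx)). Qed.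

Lemma for_continuous_eq F G x : {for x, continuous F} ->
  (\forall y \near x, F y = G y) -> {for x, continuous G}.
Proof.
move=> cF FG; have FGx := nbhs_singleton FG.
rewrite /prop_for /continuous_at -FGx; apply: (cvg_trans _ cF).
exact: (@near_eq_cvg _ _ _ (nbhs_filter x) _ _ FG).
Qed.

Lemma for_continuousD F G x : {for x, continuous F} ->
  {for x, continuous G} -> {for x, continuous (F \+ G)}.
Proof. by move=> cF cG; exact: (cvgD cF cG). Qed.

Lemma for_continuousM F G x : {for x, continuous F} ->
  {for x, continuous G} -> {for x, continuous (F \* G)}.
Proof. by move=> cF cG; exact: (cvgM cF cG). Qed.

Lemma for_continuous_cst (c : C) x : {for x, continuous (fun=> c : C)}.
Proof. exact: (@cvg_cst _ c _ (nbhs x) (nbhs_filter x)). Qed.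

(** On an open set, pointwise equality is equality near each point and passes to derivatives. The
    closure lemmas below use it to replace a partial derivative by its formula. *)
Lemma Cn_congr n W F G : Cn n W F -> open W ->
  (forall x, W x -> F x = G x) -> Cn n W G.
Proof.
move=> + oW; elim: n F G => [|n IH] F G [cF pF] FG.
  split; last exact: I.
  move=> x Wx; exact: (for_continuous_eq (cF x Wx) (near_open oW Wx FG)).
split.
  move=> x Wx; exact: (for_continuous_eq (cF x Wx) (near_open oW Wx FG)).
move=> mu; have [cvF CF] := pF mu; split.
  move=> x Wx; rewrite -(diff_quot_eq_lim mu (near_open oW Wx FG)).
  exact: (cvF x Wx).
apply: (IH _ _ CF) => x Wx; exact: (partial_local mu (near_open oW Wx FG)).
Qed.

(** The product rule leaves one factor undifferentiated; lowering its order makes the induction in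
    [CnM] work. *)
Lemma CnW n W F : Cn n.+1 W F -> Cn n W F.
Proof.
elim: n F => [|n IH] F [cF pF]; split; [exact: cF | exact: I | exact: cF |].
by move=> mu; have [cvF CF] := pF mu; split; [exact: cvF | exact: (IH _ CF)].
Qed.

Lemma Cn_subset n W W' F : W' `<=` W -> Cn n W F -> Cn n W' F.
Proof.
move=> sW; elim: n F => [|n IH] F [cF pF]; split;
  [by move=> x Wx; exact: (cF x (sW x Wx)) | exact: I
  |by move=> x Wx; exact: (cF x (sW x Wx)) |].
move=> mu; have [cvF CF] := pF mu; split; last exact: (IH _ CF).
by move=> x Wx; exact: (cvF x (sW x Wx)).
Qed.

Lemma Cn_cst n W (c : C) : open W -> Cn n W (fun=> c).
Proof.
move=> oW; elim: n c => [|n IH] c; split;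
  [by move=> x _; exact: for_continuous_cst | exact: I
  |by move=> x _; exact: for_continuous_cst |].
move=> mu; split.
  by move=> x _; apply/partial_cvgP; exists 0; exact: tends_diff_quot_cst.
by apply: (Cn_congr (IH 0) oW) => x _; rewrite partial_cst.
Qed.

Lemma CnD n W F G : open W -> Cn n W F -> Cn n W G -> Cn n W (F \+ G).
Proof.
move=> oW; elim: n F G => [|n IH] F G [cF pF] [cG pG]; split;
  [by move=> x Wx; exact: (for_continuousD (cF x Wx) (cG x Wx)) | exact: I
  |by move=> x Wx; exact: (for_continuousD (cF x Wx) (cG x Wx)) |].
move=> mu; have [cvF CF] := pF mu; have [cvG CG] := pG mu.
have FGt x (Wx : W x) :=
  tends_diff_quotD (partial_tends (cvF x Wx)) (partial_tends (cvG x Wx)).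
split.
  move=> x Wx; apply/partial_cvgP.
  by exists (partial mu F x + partial mu G x); exact: (FGt x Wx).
apply: (Cn_congr (IH _ _ CF CG) oW) => x Wx.
exact: (esym (partial_unique (FGt x Wx))).
Qed.

Lemma CnM n W F G : open W -> Cn n W F -> Cn n W G -> Cn n W (F \* G).
Proof.
move=> oW; elim: n F G => [|n IH] F G HF HG;
  have [cF pF] := HF; have [cG pG] := HG; split;
  [by move=> x Wx; exact: (for_continuousM (cF x Wx) (cG x Wx)) | exact: I
  |by move=> x Wx; exact: (for_continuousM (cF x Wx) (cG x Wx)) |].
move=> mu; have [cvF CF] := pF mu; have [cvG CG] := pG mu.
have FGt x (Wx : W x) := tends_diff_quotM (cG x Wx)
  (partial_tends (cvF x Wx)) (partial_tends (cvG x Wx)).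
split.
  move=> x Wx; apply/partial_cvgP.
  by exists (partial mu F x * G x + F x * partial mu G x); exact: (FGt x Wx).
apply: (Cn_congr (CnD oW (IH _ _ CF (CnW HG)) (IH _ _ (CnW HF) CG)) oW).
by move=> x Wx; exact: (esym (partial_unique (FGt x Wx))).
Qed.

End PartialDerivatives.

(** * Smooth functions and vector fields *)

Section SmoothFunctions.
Variables (R : realType) (b : ground) (M : manifold4 R b).
Local Notation K := (Defs.scalar R b).
Local Notation C := (Cplx R).
Implicit Types (V W : set M) (f h : M -> C) (X Y : vfield M).

Lemma chart_inv_near (phi : chart R b M) (P : M -> Prop) p : chart_dom phi p ->
  (\forall q \near p, P q) -> \forall y \near phi p, P (chart_inv phi y).
Proof.
move=> dp nP; have /chart_inv_cont : (phi @` chart_dom phi) (phi p) by exists p.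
rewrite /prop_for /continuous_at chart_mapK //; exact.
Qed.

(** Smoothness on $V$ is tested on these images, so their openness is what the coordinate lemmas
    require. *)
Lemma chart_image_open (phi : chart R b M) V : open V ->
  open (phi @` (V `&` chart_dom phi)).
Proof.
move=> oV; rewrite openE => _ [p [Vp dp] <-].
have nI : \forall y \near phi p, (phi @` chart_dom phi) y.
  by apply: open_nbhs_nbhs; split; [exact: chart_img_open | exists p].
have nV : \forall y \near phi p, V (chart_inv phi y).
  by apply: chart_inv_near => //; exact: open_nbhs_nbhs.
apply: filterS2 nI nV => _ [q dq <-]; rewrite chart_mapK // => Vq.
by exists q.
Qed.

Lemma smooth_congr V f h : open V -> smooth V f ->
  (forall q, V q -> f q = h q) -> smooth V h.
Proof.
move=> oV sf fh phi aphi n.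
apply: (Cn_congr (sf phi aphi n)); first exact: chart_image_open.
by move=> _ [q [Vq dq] <-] /=; rewrite chart_mapK // fh.
Qed.

Lemma smooth_subset V W f : W `<=` V -> smooth V f -> smooth W f.
Proof.
move=> WV sf phi aphi n; apply: Cn_subset (sf phi aphi n).
by move=> _ [q [/WV Vq dq] <-]; exists q.
Qed.

Lemma smooth_cst V (c : C) : open V -> smooth V (fun=> c).
Proof. by move=> oV phi _ n; apply: Cn_cst; exact: chart_image_open. Qed.

Lemma smoothD V f h : open V -> smooth V f -> smooth V h ->
  smooth V (fun q => f q + h q).
Proof.
move=> oV sf sh phi aphi n.
exact: (CnD (chart_image_open oV) (sf _ aphi n) (sh _ aphi n)).
Qed.

Lemma smoothM V f h : open V -> smooth V f -> smooth V h ->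
  smooth V (fun q => f q * h q).
Proof.
move=> oV sf sh phi aphi n.
exact: (CnM (chart_image_open oV) (sf _ aphi n) (sh _ aphi n)).
Qed.

Lemma smoothN V f : open V -> smooth V f -> smooth V (fun q => - f q).
Proof.
move=> oV sf; apply: (smooth_congr oV (smoothM oV (smooth_cst (-1) oV) sf)).
by move=> q _; rewrite mulN1r.
Qed.

Lemma smoothB V f h : open V -> smooth V f -> smooth V h ->
  smooth V (fun q => f q - h q).
Proof. by move=> oV sf sh; exact: (smoothD oV sf (smoothN oV sh)). Qed.

(** Near $p$ the function is its coordinate expression composed with the chart. This later makes the
    set where a connection coefficient is nonzero open. *)
Lemma smooth_cont V f p : smooth V f -> V p -> {for p, continuous f}.
Proof.
move=> sf Vp; have [aphi dp] := (chart_at_atlas p, chart_at_dom p).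
have /= [cf _] := sf _ aphi 0%N.
have cphi := chart_map_cont dp.
have cfp : {for chart_at p p, continuous (f \o chart_inv (chart_at p))}.
  by apply: cf; exists p.
have cc : f (chart_inv (chart_at p) (chart_at p q)) @[q --> p] -->
    f (chart_inv (chart_at p) (chart_at p p)) := continuous_comp cphi cfp.
rewrite (chart_mapK dp) in cc; apply: (cvg_trans _ cc).
apply: (@near_eq_cvg _ _ _ (nbhs_filter p)).
have := open_nbhs_nbhs (conj (@chart_dom_open _ _ _ (chart_at p)) dp).
by apply: filterS => q dq; rewrite (chart_mapK dq).
Qed.

Lemma act_local X f h p : (\forall q \near p, f q = h q) ->
  act X f p = act X h p.
Proof.
move=> fh; apply: eq_bigr => mu _; congr (_ * _); apply: partial_local.
exact: (chart_inv_near (P := fun q => f q = h q) (chart_at_dom p) fh).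
Qed.

Lemma act_congr V X f h p : open V -> V p -> (forall q, V q -> f q = h q) ->
  act X f p = act X h p.
Proof.
move=> oV Vp fh; apply: act_local.
exact: filterS (open_nbhs_nbhs (conj oV Vp)).
Qed.

Lemma act_cst X (c : C) p : act X (fun=> c) p = 0.
Proof.
by apply: big1 => mu _; rewrite [partial _ _ _]partial_cst mulr0.
Qed.

Lemma smooth_tends V f p mu : smooth V f -> V p ->
  tends (diff_quot (f \o chart_inv (chart_at p)) (chart_at p p) mu)
        (partial mu (f \o chart_inv (chart_at p)) (chart_at p p)).
Proof.
move=> sf Vp; apply: partial_tends.
have [_ /(_ mu)[+ _]] := sf _ (chart_at_atlas p) 1%N.
by apply; exists p => //; split=> //; exact: chart_at_dom.
Qed.

Lemma actD V X f h p : smooth V f -> smooth V h -> V p ->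
  act X (fun q => f q + h q) p = act X f p + act X h p.
Proof.
move=> sf sh Vp; rewrite /act -big_split; apply: eq_bigr => mu _ /=.
rewrite -mulrDr; congr (_ * _); apply: partial_unique.
exact: (tends_diff_quotD (smooth_tends sf Vp) (smooth_tends sh Vp)).
Qed.

Lemma actM V X f h p : smooth V f -> smooth V h -> V p ->
  act X (fun q => f q * h q) p = act X f p * h p + f p * act X h p.
Proof.
move=> sf sh Vp; rewrite /act mulr_suml mulr_sumr -big_split.
apply: eq_bigr => mu _ /=.
have dp := chart_at_dom p.
have -> : partial mu ((fun q => f q * h q) \o chart_inv (chart_at p))
    (chart_at p p) =
  partial mu (f \o chart_inv (chart_at p)) (chart_at p p) * h p +
  f p * partial mu (h \o chart_inv (chart_at p)) (chart_at p p).
  have ch : {for chart_at p p, continuous (h \o chart_inv (chart_at p))}.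
    by have /= [ch _] := sh _ (chart_at_atlas p) 0%N; apply: ch; exists p.
  have := partial_unique
    (tends_diff_quotM ch (smooth_tends (mu := mu) sf Vp) (smooth_tends sh Vp)).
  rewrite /= (chart_mapK dp); exact.
by ring.
Qed.

Lemma actN V X f p : open V -> smooth V f -> V p ->
  act X (fun q => - f q) p = - act X f p.
Proof.
move=> oV sf Vp; have := actM X (smooth_cst (-1) oV) sf Vp.
rewrite act_cst mul0r add0r mulN1r => <-.
by apply: (act_congr X oV Vp) => q _; rewrite mulN1r.
Qed.

(** * Coordinate functions and operations on vector fields *)

Definition coordf (p : M) (mu : 'I_4) : M -> C :=
  fun q => embed (chart_at p q 0 mu).

Lemma coordf_smooth p mu : smooth (chart_dom (chart_at p)) (coordf p mu).
Proof.
move=> phi aphi; rewrite setIC.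
exact: (atlas_compatible aphi (chart_at_atlas p)).
Qed.

(** In the chart selected at $p$ the function is a linear coordinate, with Kronecker deltas as
    partial derivatives. Identities between derivations thus become identities between tangent
    vectors when tested on coordinates. *)
Lemma act_coordf X p mu : act X (coordf p mu) p = X p 0 mu.
Proof.
rewrite /act (bigD1 mu) //= big1 ?addr0 => [|nu neq]; last first.
  have -> : partial nu (coordf p mu \o chart_inv (chart_at p)) (chart_at p p) = 0.
    rewrite -[RHS](_ : (nu == mu)%:R = 0); last by rewrite (negbTE neq).
    rewrite -(partial_coord (chart_at p p)); apply: partial_local.
    apply: filterS (open_nbhs_nbhs (conj (@chart_img_open _ _ _ (chart_at p)) _)).
      by move=> _ [q dq <-]; rewrite /= /coordf chart_mapK.
    by exists p => //; exact: chart_at_dom.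
  by rewrite mulr0.
have -> : partial mu (coordf p mu \o chart_inv (chart_at p)) (chart_at p p) = 1.
  rewrite -[RHS](_ : (mu == mu)%:R = 1); last by rewrite eqxx.
  rewrite -(partial_coord (chart_at p p)); apply: partial_local.
  apply: filterS (open_nbhs_nbhs (conj (@chart_img_open _ _ _ (chart_at p)) _)).
    by move=> _ [q dq <-]; rewrite /= /coordf chart_mapK.
  by exists p => //; exact: chart_at_dom.
by rewrite mulr1.
Qed.

Lemma lie_bracketE X Y p mu : lie_bracket X Y p 0 mu =
  act X (act Y (coordf p mu)) p - act Y (act X (coordf p mu)) p.
Proof. by rewrite mxE. Qed.

Lemma act_fieldD X Y f p :
  act (fun q => X q + Y q) f p = act X f p + act Y f p.
Proof.
by rewrite /act -big_split; apply: eq_bigr => mu _; rewrite /= mxE mulrDl.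
Qed.

Lemma act_fieldZ f X h p : act (fun q => f q *: X q) h p = f p * act X h p.
Proof.
by rewrite /act mulr_sumr; apply: eq_bigr => mu _; rewrite mxE mulrA.
Qed.

Lemma act_field_congr X Y f p : X p = Y p -> act X f p = act Y f p.
Proof. by rewrite /act => ->. Qed.

Lemma smooth_field_subset V W X : W `<=` V -> smooth_field V X ->
  smooth_field W X.
Proof. by move=> WV sX W' oW' W'W; apply: sX => //; exact: subset_trans WV. Qed.

Lemma smooth_fieldD V X Y : smooth_field V X -> smooth_field V Y ->
  smooth_field V (fun q => X q + Y q).
Proof.
move=> sX sY W oW WV f sf.
apply: (smooth_congr oW (smoothD oW (sX W oW WV f sf) (sY W oW WV f sf))).
by move=> q _; rewrite act_fieldD.
Qed.

Lemma smooth_fieldZ V f X : smooth V f -> smooth_field V X ->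
  smooth_field V (fun q => f q *: X q).
Proof.
move=> sf sX W oW WV h sh.
apply: (smooth_congr oW (smoothM oW (smooth_subset WV sf) (sX W oW WV h sh))).
by move=> q _; rewrite act_fieldZ.
Qed.

End SmoothFunctions.

(** * Frame calculus *)

(* g(e_a, e_c) = 1 if c = dual a, and 0 otherwise. *)
Definition dual (a : 'I_4) : 'I_4 := nth i1 [:: i2; i1; i4; i3] a.

Lemma sum4 (V : nmodType) (F : 'I_4 -> V) :
  \sum_(f < 4) F f = F i1 + F i2 + F i3 + F i4.
Proof.
rewrite !big_ord_recr big_ord0 /= add0r.
by congr (_ + _ + _ + _); congr F; apply: val_inj.
Qed.

Lemma ord4_ind (P : 'I_4 -> Prop) : P i1 -> P i2 -> P i3 -> P i4 -> forall a, P a.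
Proof.
move=> p1 p2 p3 p4 [[|[|[|[|//]]]] a4].
- by rewrite (_ : Ordinal a4 = i1) //; exact: val_inj.
- by rewrite (_ : Ordinal a4 = i2) //; exact: val_inj.
- by rewrite (_ : Ordinal a4 = i3) //; exact: val_inj.
- by rewrite (_ : Ordinal a4 = i4) //; exact: val_inj.
Qed.

Lemma dualK : involutive dual.
Proof. by elim/ord4_ind. Qed.

(* S is the set of smooth functions on U and D c the derivation along e_c. The
   field is abstract because unification over [Cplx R] would unfold the
   operations of R[i]. *)
Record derivations (K : comNzRingType) (M : Type) (U : M -> Prop)
    (S : (M -> K) -> Prop) (D : 'I_4 -> (M -> K) -> M -> K) : Prop := {
  der_addS : forall f h, S f -> S h -> S (fun q => f q + h q);
  der_oppS : forall f, S f -> S (fun q => - f q);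
  der_mulS : forall f h, S f -> S h -> S (fun q => f q * h q);
  derS : forall c f, S f -> S (D c f);
  der_cstS : forall k, S (fun=> k);
  der_cst : forall c k q, U q -> D c (fun=> k) q = 0;
  der_congr : forall c f h, (forall q, U q -> f q = h q) ->
    forall q, U q -> D c f q = D c h q;
  der_add : forall c f h, S f -> S h -> forall q, U q ->
    D c (fun p => f p + h p) q = D c f q + D c h q;
  der_opp : forall c f, S f -> forall q, U q ->
    D c (fun p => - f p) q = - D c f q;
  der_mul : forall c f h, S f -> S h -> forall q, U q ->
    D c (fun p => f p * h p) q = D c f q * h q + f q * D c h q
}.

(** * Abstract derivations and the Jacobi identity *)

Section Derivations.
Variables (K : comNzRingType) (M : Type) (U : M -> Prop).
Variables (S : (M -> K) -> Prop) (D : 'I_4 -> (M -> K) -> M -> K).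
Hypothesis hD : derivations U S D.

Lemma der_subS f h : S f -> S h -> S (fun q => f q - h q).
Proof. by move=> sf sh; exact: (der_addS hD sf (der_oppS hD sh)). Qed.

Lemma der_sub c f h : S f -> S h -> forall q, U q ->
  D c (fun p => f p - h p) q = D c f q - D c h q.
Proof.
move=> sf sh q Uq.
by rewrite (der_add hD _ sf (der_oppS hD sh) Uq) (der_opp hD _ sh Uq).
Qed.

Lemma der_sum4 c (u v : 'I_4 -> M -> K) q : U q ->
  (forall j, S (u j)) -> (forall j, S (v j)) ->
  D c (fun p => \sum_(j < 4) u j p * v j p) q =
  \sum_(j < 4) (D c (u j) q * v j q + u j q * D c (v j) q).
Proof.
move=> Uq su sv; have suv j := der_mulS hD (su j) (sv j).
rewrite (der_congr hD _ (h := fun p => u i1 p * v i1 p + u i2 p * v i2 p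
  + u i3 p * v i3 p + u i4 p * v i4 p) _ Uq); last by move=> p _; rewrite sum4.
have s2 := der_addS hD (suv i1) (suv i2); have s3 := der_addS hD s2 (suv i3).
rewrite (der_add hD _ s3 (suv i4) Uq) (der_add hD _ s2 (suv i3) Uq).
rewrite (der_add hD _ (suv i1) (suv i2) Uq) sum4.
by rewrite !(der_mul hD _ (su _) (sv _) Uq).
Qed.

Variable T : 'I_4 -> 'I_4 -> 'I_4 -> M -> K.
Hypothesis T_S : forall f c d, S (T f c d).

(** The coefficient of $D_j$ in $[D_c,[D_d,D_l]]$. *)
Definition jac c d l j q :=
  D c (T j d l) q + \sum_(f < 4) T f d l q * T j c f q.

(* The Jacobi identity for the commutators [[D_c, D_d] = sum_j T^j_cd D_j]. *)
Lemma jac_cyclic x c d l q : U q -> S x ->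
  (forall y, S y -> forall a b p, U p -> 
     D a (D b y) p - D b (D a y) p = \sum_(j < 4) T j a b p * D j y p) ->
  \sum_(k < 4) (jac c d l k q + jac d l c k q + jac l c d k q) * D k x q = 0.
Proof.
move=> Uq sx comm.
(* The double commutator $[D_c,[D_d,D_l]]x$, with its third-order terms distributed so that they
   cancel in the sum over cyclic permutations of $(c,d,l)$. *)
have jacE c' d' l' : D c' (D d' (D l' x)) q - D c' (D l' (D d' x)) q =
  D d' (D l' (D c' x)) q - D l' (D d' (D c' x)) q +
  \sum_(k < 4) jac c' d' l' k q * D k x q.
  have sD k f : S f -> S (D k f) := @derS _ _ _ _ _ hD k f.
  rewrite -(der_sub _ (sD d' _ (sD l' _ sx)) (sD l' _ (sD d' _ sx)) Uq).
  rewrite (der_congr hD _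
    (h := fun p => \sum_(k < 4) T k d' l' p * D k x p) _ Uq);
    last by move=> p Up; exact: comm.
  rewrite (der_sum4 _ Uq (fun k => @T_S k d' l') (fun k => sD k _ sx)).
  rewrite (comm _ (sD c' _ sx) d' l' _ Uq) /jac.
  have cc k : D c' (D k x) q =
      D k (D c' x) q + \sum_(f < 4) T f c' k q * D f x q.
    by rewrite -(comm _ sx _ _ _ Uq) addrC subrK.
  by rewrite !sum4 !cc !sum4; ring.
have H1 := jacE c d l; have H2 := jacE d l c; have H3 := jacE l c d.
transitivity (\sum_(k < 4) jac c d l k q * D k x q +
   \sum_(k < 4) jac d l c k q * D k x q + \sum_(k < 4) jac l c d k q * D k x q).
  by rewrite !sum4; ring.
move: H1 H2 H3.
set s1 := \sum_(k < 4) _; set s2 := \sum_(k < 4) _; set s3 := \sum_(k < 4) _.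
move=> /esym/(canRL (addKr _)) -> /esym/(canRL (addKr _)) ->.
move=> /esym/(canRL (addKr _)) ->.
by ring.
Qed.

End Derivations.

(* G a b c = Gamma_{abc}, and
   T f c d = theta^f([e_c, e_d]) = Gamma^f_{dc} - Gamma^f_{cd}. *)
Record frame_calculus (K : comNzRingType) (M : Type) (U : M -> Prop)
    (S : (M -> K) -> Prop) (D : 'I_4 -> (M -> K) -> M -> K)
    (T G : 'I_4 -> 'I_4 -> 'I_4 -> M -> K) : Prop := {
  fc_der : derivations U S D;
  fcG_S : forall a b c, S (G a b c);
  fcT : forall f c d q, T f c d q = G (dual f) d c q - G (dual f) c d q;
  fcG_anti : forall a b c q, U q -> G a b c q = - G b a c q;
  fc_comm : forall f, S f -> forall c d q, U q ->
    D c (D d f) q - D d (D c f) q = \sum_(j < 4) T j c d q * D j f q;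
  fc_jac : forall j c d l q, U q ->
    jac D T c d l j q + jac D T d l c j q + jac D T l c d j q = 0
}.

(** * Curvature in the frame and its symmetries *)

Section FrameCalculus.
Variables (K : numFieldType) (M : Type) (U : M -> Prop).
Variables (S : (M -> K) -> Prop) (D : 'I_4 -> (M -> K) -> M -> K).
Variables (T G : 'I_4 -> 'I_4 -> 'I_4 -> M -> K).
Hypothesis hF : frame_calculus U S D T G.
Let hD := fc_der hF.
Let G_S := fcG_S hF.
Let TE := fcT hF.
Let G_anti := fcG_anti hF.

Lemma fcT_S f c d : S (T f c d).
Proof.
have -> : T f c d = fun q => G (dual f) d c q - G (dual f) c d q.
  by apply/funext => q.
exact: (der_subS hD).
Qed.

(** The components $R_{abcd}=g(e_a,R(e_c,e_d)e_b)$ written through connection coefficients; [dual f]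
    raises an index because the frame metric is a constant pairing. Agreement with [curvature] is
    proved in [curvature_frame]. *)
Definition riemann a b c d : M -> K := fun q =>
  D c (G a b d) q - D d (G a b c) q
  + \sum_(f < 4) (G a (dual f) c q * G f b d q - G a (dual f) d q * G f b c q)
  - \sum_(f < 4) T f c d q * G a b f q.

Lemma fc_sum4S u : (forall j, S (u j)) -> S (fun q => \sum_(j < 4) u j q).
Proof.
move=> su; have -> : (fun q => \sum_(j < 4) u j q)
    = fun q => u i1 q + u i2 q + u i3 q + u i4 q.
  by apply/funext => q; rewrite sum4.
by do !apply: (der_addS hD).
Qed.

Lemma riemann_S a b c d : S (riemann a b c d).
Proof.
apply: (der_subS hD); [apply: (der_addS hD)|]; [apply: (der_subS hD)| |].
- exact: (derS hD).
- exact: (derS hD).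
- apply: fc_sum4S => j.
  by apply: (der_subS hD); apply: (der_mulS hD).
- by apply: fc_sum4S => j; apply: (der_mulS hD) => //; exact: fcT_S.
Qed.

Lemma riemann_antir a b c d q : riemann a b d c q = - riemann a b c d q.
Proof. by rewrite /riemann !sum4 !TE; ring. Qed.

Lemma riemann_antil a b c d q : U q -> riemann b a c d q = - riemann a b c d q.
Proof.
move=> Uq; rewrite /riemann.
have DG k l : D k (G b a l) q = - D k (G a b l) q.
  rewrite -(der_opp hD _ (@G_S a b l) Uq).
  by apply: (der_congr hD _ _ Uq) => p; exact: G_anti.
rewrite !DG !sum4 !(G_anti b _ _ Uq) !(G_anti _ a _ Uq) /dual /=.
ring.
Qed.

(** The first Bianchi identity: with the torsion-free expression of [T] through [G], the cyclic sum
    becomes the Jacobi expression for the structure coefficients with upper index [dual a]. *)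
Lemma riemann_cyclic a b c d q : U q ->
  riemann a b c d q + riemann a c d b q + riemann a d b c q = 0.
Proof.
move=> Uq; rewrite -[RHS](fc_jac hF (dual a) b c d Uq) /riemann /jac.
have DT k l m : D k (T (dual a) l m) q = D k (G a m l) q - D k (G a l m) q.
  rewrite -(der_sub hD _ (@G_S a m l) (@G_S a l m) Uq).
  by apply: (der_congr hD _ _ Uq) => p; rewrite TE dualK.
by rewrite !DT !sum4 !TE dualK /dual /=; ring.
Qed.

(** The cyclic identities starting at $a,b,c,d$, taken with signs $+,-,-,+$, leave
    $2(R_{abcd}-R_{cdab})$ after the antisymmetries are applied. *)
Lemma riemann_pair a b c d q : U q -> riemann a b c d q = riemann c d a b q.
Proof.
move=> Uq; apply: (mulfI (_ : 2%:R != 0 :> K)); first by rewrite pnatr_eq0.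
have E1 := riemann_cyclic a b c d Uq; have E2 := riemann_cyclic b c d a Uq.
have E3 := riemann_cyclic c d a b Uq; have E4 := riemann_cyclic d a b c Uq.
apply/eqP; rewrite -subr_eq0; apply/eqP.
transitivity ((riemann a b c d q + riemann a c d b q + riemann a d b c q)
 - (riemann b c d a q + riemann b d a c q + riemann b a c d q)
 - (riemann c d a b q + riemann c a b d q + riemann c b d a q)
 + (riemann d a b c q + riemann d b c a q + riemann d c a b q)); last first.
  by rewrite E1 E2 E3 E4 !subr0 addr0.
rewrite (riemann_antil a b _ _ Uq) (riemann_antil a c _ _ Uq)
  (riemann_antil b c _ _ Uq).
rewrite (riemann_antil a d _ _ Uq) (riemann_antil b d _ _ Uq)
  (riemann_antil c d a _ Uq).
rewrite (riemann_antir a c d b) (riemann_antir b d c a).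
ring.
Qed.

(** * Exterior derivative of 1-forms in the frame *)

Definition extd (u : 'I_4 -> M -> K) c d : M -> K := fun q =>
  D c (u d) q - D d (u c) q - \sum_(f < 4) T f c d q * u f q.

(** This is $d^2u=0$ on $(e_b,e_c,e_d)$, the right-hand side being the bracket terms of the
    derivative of a 2-form. Second derivatives of $u$ cancel through the commutators, derivatives of
    [T] through the Jacobi identity. *)
Lemma extd2 u b c d q : (forall a, S (u a)) -> U q ->
  D b (extd u c d) q + D c (extd u d b) q + D d (extd u b c) q
  = \sum_(f < 4) (T f b c q * extd u f d q + T f c d q * extd u f b q
                  + T f d b q * extd u f c q).
Proof.
move=> su Uq.
have sDu k l : S (D k (u l)) by exact: (derS hD).
have sT k l m : S (T k l m) by exact: fcT_S.
have DE k l m : D k (extd u l m) q = D k (D l (u m)) q - D k (D m (u l)) q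
    - \sum_(f < 4) (D k (T f l m) q * u f q + T f l m q * D k (u f) q).
  rewrite (der_sub hD _ (der_subS hD (sDu l m) (sDu m l)) _ Uq); last first.
    by apply: fc_sum4S => j; apply: (der_mulS hD).
  by rewrite (der_sub hD _ (sDu l m) (sDu m l) Uq) (der_sum4 hD _ Uq).
have cc k l m : D k (D l (u m)) q =
    D l (D k (u m)) q + \sum_(f < 4) T f k l q * D f (u m) q.
  by rewrite -(fc_comm hF (su m) _ _ Uq) addrC subrK.
rewrite !DE (cc b c d) (cc c d b) (cc d b c).
have J f := fc_jac hF f b c d Uq.
have JJ : \sum_(f < 4) (jac D T b c d f q + jac D T c d b f q
   + jac D T d b c f q) * u f q = 0.
  by rewrite sum4 !J !mul0r !addr0.
rewrite -[RHS]subr0 -[X in _ = _ - X]JJ /jac /extd !sum4 !TE.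
ring.
Qed.

Lemma der0 c f k q : (forall p, U p -> f p = k) -> U q -> D c f q = 0.
Proof. by move=> f0 Uq; rewrite (der_congr hD _ f0 Uq) (der_cst hD). Qed.

Lemma G_diag a c q : U q -> G a a c q = 0.
Proof.
move=> Uq; have /eqP := G_anti a a c Uq.
by rewrite -addr_eq0 -mulr2n mulrn_eq0 /= => /eqP.
Qed.

(** Rewrite rules that order the first two indices of every [G a b c], leaving only independent
    coefficients for [ring]. *)
Definition G_norm q (Uq : U q) :=
  (fun c => G_diag i1 c Uq, fun c => G_diag i2 c Uq,
   fun c => G_diag i3 c Uq, fun c => G_diag i4 c Uq,
   fun c => G_anti i2 i1 c Uq, fun c => G_anti i3 i1 c Uq,
   fun c => G_anti i4 i1 c Uq, fun c => G_anti i3 i2 c Uq,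
   fun c => G_anti i4 i2 c Uq, fun c => G_anti i4 i3 c Uq).

(** * Selfdual connection forms, structure equations and Bianchi identities *)

Definition sdA c : M -> K := G i1 i4 c.
Definition sdB c : M -> K := fun q => G i3 i4 c q - G i1 i2 c q.
Definition sdC c : M -> K := G i2 i3 c.

Lemma sdA_S c : S (sdA c). Proof. exact: G_S. Qed.
Lemma sdB_S c : S (sdB c). Proof. exact: (der_subS hD). Qed.
Lemma sdC_S c : S (sdC c). Proof. exact: G_S. Qed.

Definition sdF := riemann i1 i4.
Definition sdG c d : M -> K := fun q =>
  riemann i3 i4 c d q - riemann i1 i2 c d q.
Definition sdH := riemann i2 i3.

(** The Lie algebra $\mathfrak{so}(4,\mathbb C)$ is a sum of two commuting ideals, so the quadratic
    terms of a selfdual curvature component involve only [sdA], [sdB] and [sdC]. The same holds for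
    the next two structure equations. *)
Lemma sdF_structure c d q : U q ->
  sdF c d q = extd sdA c d q + (sdA c q * sdB d q - sdA d q * sdB c q).
Proof.
move=> Uq; rewrite /sdF /riemann /extd /sdA /sdB !sum4 /dual /= !(G_norm Uq).
ring.
Qed.

Lemma sdG_structure c d q : U q ->
  sdG c d q = extd sdB c d q + 2%:R * (sdA c q * sdC d q - sdA d q * sdC c q).
Proof.
move=> Uq; rewrite /sdG /riemann /extd.
have DB k l : D k (sdB l) q = D k (G i3 i4 l) q - D k (G i1 i2 l) q.
  exact: (der_sub hD).
rewrite !DB /sdA /sdB /sdC !sum4 /dual /= !(G_norm Uq).
ring.
Qed.

Lemma sdH_structure c d q : U q ->
  sdH c d q = extd sdC c d q + (sdB c q * sdC d q - sdB d q * sdC c q).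
Proof.
move=> Uq; rewrite /sdH /riemann /extd /sdB /sdC !sum4 /dual /= !(G_norm Uq).
ring.
Qed.

Lemma extd_S u c d : (forall a, S (u a)) -> S (extd u c d).
Proof.
move=> su; apply: (der_subS hD); first by apply: (der_subS hD); exact: (derS hD).
by apply: fc_sum4S => j; apply: (der_mulS hD) => //; exact: fcT_S.
Qed.

Lemma der_wedge b c d (w u v : 'I_4 -> M -> K) (f : M -> K) q : U q ->
  (forall a, S (w a)) -> (forall a, S (u a)) -> (forall a, S (v a)) ->
  (forall p, U p ->
     f p = extd w c d p + (u c p * v d p - u d p * v c p)) ->
  D b f q = D b (extd w c d) q + (D b (u c) q * v d q + u c q * D b (v d) q
    - (D b (u d) q * v c q + u d q * D b (v c) q)).
Proof.
move=> Uq sw su sv fE; rewrite (der_congr hD _ fE Uq).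
have suv k l : S (fun p => u k p * v l p) by exact: (der_mulS hD).
rewrite (der_add hD _ (extd_S c d sw) (der_subS hD (suv c d) (suv d c)) Uq).
rewrite (der_sub hD _ (suv c d) (suv d c) Uq).
by rewrite !(der_mul hD _ (su _) (sv _) Uq).
Qed.

Definition cyc (w : 'I_4 -> 'I_4 -> 'I_4 -> K) b c d :=
  w b c d + w c d b + w d b c.

(* dF = F /\ B - A /\ G *)
Lemma bianchi_sdF b c d q : U q ->
  cyc (fun b c d => D b (sdF c d) q - \sum_(f < 4) T f b c q * sdF f d q) b c d =
  cyc (fun b c d => sdF c d q * sdB b q - sdA b q * sdG c d q) b c d.
Proof.
move=> Uq; rewrite /cyc.
have DF k l m := der_wedge k Uq sdA_S sdA_S sdB_S
  (fun p Up => sdF_structure l m Up).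
have X := extd2 b c d sdA_S Uq.
(* The difference of the two sides is matched with that of $d^2A=0$. The derivatives of [extd] are
   named below so that unfolding [extd] leaves them intact. *)
rewrite !DF; apply/eqP; rewrite -subr_eq0; move/eqP: X; rewrite -subr_eq0.
congr (_ == _); rewrite !sum4 !(sdF_structure _ _ Uq) !(sdG_structure _ _ Uq).
set x1 := D b (extd _ _ _) q; set x2 := D c (extd _ _ _) q.
set x3 := D d (extd _ _ _) q.
rewrite /extd !sum4 !TE; ring.
Qed.

(* dG = 2 (F /\ C - A /\ H) *)
Lemma bianchi_sdG b c d q : U q ->
  cyc (fun b c d => D b (sdG c d) q - \sum_(f < 4) T f b c q * sdG f d q) b c d =
  2%:R * cyc (fun b c d => sdF c d q * sdC b q - sdA b q * sdH c d q) b c d.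
Proof.
move=> Uq; rewrite /cyc.
(* The factor of $2A\wedge C$ is absorbed into the form $u=2A$, so that [der_wedge] applies. *)
pose u a : M -> K := fun q => 2%:R * sdA a q.
have su a : S (u a) by apply: (der_mulS hD); [exact: (der_cstS hD) | exact: sdA_S].
have Du k a : D k (u a) q = 2%:R * D k (sdA a) q.
  rewrite (der_mul hD _ (der_cstS hD _) (sdA_S a) Uq) (der_cst hD) //.
  by rewrite mul0r add0r.
have DG k l m : D k (sdG l m) q = D k (extd sdB l m) q
    + (D k (u l) q * sdC m q + u l q * D k (sdC m) q
    - (D k (u m) q * sdC l q + u m q * D k (sdC l) q)).
  apply: (der_wedge k Uq sdB_S su sdC_S) => p Up.
  by rewrite sdG_structure // /u; ring.
have X := extd2 b c d sdB_S Uq.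
rewrite !DG !Du; apply/eqP; rewrite -subr_eq0; move/eqP: X; rewrite -subr_eq0.
congr (_ == _); rewrite !sum4 !(sdF_structure _ _ Uq) !(sdG_structure _ _ Uq).
rewrite !(sdH_structure _ _ Uq) /u.
set x1 := D b (extd _ _ _) q; set x2 := D c (extd _ _ _) q.
set x3 := D d (extd _ _ _) q.
rewrite /extd !sum4 !TE; ring.
Qed.

End FrameCalculus.

(** * The selfdual connection *)

(** Reduces a linear consequence of a known equation to a [ring] identity; the multiplier [k] is
    $\pm1$ in every use. *)
Lemma eq_lincomb (K : comNzRingType) (k u v x y : K) :
  u = v -> x - y = k * (u - v) -> x = y.
Proof. by move=> -> /eqP; rewrite subrr mulr0 subr_eq0 => /eqP. Qed.

Section SelfdualPlane.
Variables (K : numFieldType) (M : Type) (U : M -> Prop).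
Variables (S : (M -> K) -> Prop) (D : 'I_4 -> (M -> K) -> M -> K).
Variables (T G : 'I_4 -> 'I_4 -> 'I_4 -> M -> K).
Hypothesis hF : frame_calculus U S D T G.
Let hD := fc_der hF.
Let TE := fcT hF.
Local Notation R := (riemann D T G).
Local Notation A := (sdA G).
Local Notation B := (sdB G).
Local Notation F := (sdF D T G).
Local Notation Gc := (sdG D T G).
Local Notation H := (sdH D T G).

Lemma sdF_anti c d q : F d c q = - F c d q.
Proof. exact: (riemann_antir hF). Qed.

Lemma sdG_anti c d q : Gc d c q = - Gc c d q.
Proof. by rewrite /sdG !(riemann_antir hF _ _ c d); ring. Qed.

Lemma sdH_anti c d q : H d c q = - H c d q.
Proof. exact: (riemann_antir hF). Qed.

Lemma anti0 (w : 'I_4 -> 'I_4 -> M -> K) c q :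
  (forall c d q, w d c q = - w c d q) -> w c c q = 0.
Proof.
move=> wN; have /eqP := wN c c q.
by rewrite -addr_eq0 -mulr2n mulrn_eq0 /= => /eqP.
Qed.

Lemma sdG14 q : U q -> Gc i1 i4 q = F i3 i4 q - F i1 i2 q.
Proof.
by move=> Uq; rewrite /sdG (riemann_pair hF _ _ _ _ Uq) (riemann_pair hF i1 i2 _ _ Uq).
Qed.

(** * Integrable null planes *)

Section Integrable.
Hypotheses (A1 : forall q, U q -> A i1 q = 0) (A4 : forall q, U q -> A i4 q = 0).

(** Since $T^2{}_{14}=A_1$ and $T^3{}_{14}=A_4$, the bracket of $e_1$ and $e_4$ stays in their span,
    on which $A$ vanishes; hence $dA(e_1,e_4)=0$. *)
Lemma integrable_F14 q : U q -> F i1 i4 q = 0.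
Proof.
move=> Uq; rewrite (sdF_structure hF _ _ Uq) /extd.
rewrite (der0 hF _ A4 Uq) (der0 hF _ A1 Uq) (A1 Uq) (A4 Uq) sum4 (A1 Uq) (A4 Uq).
have := A1 Uq; have := A4 Uq; rewrite /sdA => a4 a1.
rewrite !TE /dual /= !(G_norm hF Uq) a1 a4; ring.
Qed.

Hypotheses (F13 : forall q, U q -> F i1 i3 q = 0).
Hypotheses (F24 : forall q, U q -> F i2 i4 q = 0).
Hypotheses (F12 : forall q, U q -> F i1 i2 q = - F i3 i4 q).
Let psi := F i3 i4.

(** All known components as one rewrite rule; [psi] and $F_{23}$ are the curvature components
    left. *)
Let Fvals q (Uq : U q) :
  ((F i1 i4 q = 0) * (F i4 i1 q = 0) * (F i1 i3 q = 0) * (F i3 i1 q = 0)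
  * (F i2 i4 q = 0) * (F i4 i2 q = 0) * (F i1 i2 q = - psi q)
  * (F i2 i1 q = psi q) * (F i3 i4 q = psi q) * (F i4 i3 q = - psi q)
  * (F i3 i2 q = - F i2 i3 q) * (F i1 i1 q = 0) * (F i2 i2 q = 0)
  * (F i3 i3 q = 0) * (F i4 i4 q = 0) * (Gc i1 i4 q = (psi q + psi q)%R)
  * (Gc i4 i1 q = (- (psi q + psi q))%R) * (A i1 q = 0) * (A i4 q = 0))%type.
Proof.
have d c := @anti0 F c q sdF_anti.
have s := sdF_anti.
have g : Gc i1 i4 q = psi q + psi q by rewrite sdG14 // F12 // opprK.
do !split; rewrite ?d ?A1 ?A4 ?F12 ?F13 ?F24 ?integrable_F14 //.
- by rewrite s integrable_F14 ?oppr0.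
- by rewrite s F13 ?oppr0.
- by rewrite s F24 ?oppr0.
- by rewrite s F12 ?opprK.
- by rewrite sdG_anti g.
Qed.

Lemma integrable_D4psi q : U q ->
  D i4 psi q = (B i4 q - 4%:R * A i2 q) * psi q.
Proof.
move=> Uq; have := bianchi_sdF hF i1 i2 i4 Uq; rewrite /cyc.
(* Of the three derivatives in the Bianchi identity only $D_4F_{12}=-D_4\psi$ survives. *)
rewrite (der0 hF i1 F24 Uq).
rewrite (der0 (k := 0) hF i2 (f := F i4 i1)) //; last by move=> p Up; rewrite Fvals.
rewrite (der_congr hD _ F12 Uq) (der_opp hD) //; last exact: (riemann_S hF).
rewrite -/psi !sum4 !(Fvals Uq) => /(eq_lincomb (k := -1)); apply.
have [a1 a4] := (A1 Uq, A4 Uq).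
rewrite /sdA /sdB in a1 a4 *.
rewrite !TE /dual /= !(G_norm hF Uq) a1 a4; ring.
Qed.

Lemma integrable_D1psi q : U q ->
  D i1 psi q = (B i1 q + 4%:R * A i3 q) * psi q.
Proof.
move=> Uq; have := bianchi_sdF hF i1 i3 i4 Uq; rewrite /cyc.
rewrite (der0 hF i4 F13 Uq).
rewrite (der0 (k := 0) hF i3 (f := F i4 i1)) //; last by move=> p Up; rewrite Fvals.
rewrite -/psi !sum4 !(Fvals Uq) => /(eq_lincomb (k := 1)); apply.
have [a1 a4] := (A1 Uq, A4 Uq).
rewrite /sdA /sdB in a1 a4 *.
rewrite !TE /dual /= !(G_norm hF Uq) a1 a4; ring.
Qed.

Lemma integrable_F34 q : U q -> F i3 i4 q = 0.
Proof.
move=> Uq; rewrite -/psi.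
have sA a := sdA_S hF a; have sB a := sdB_S hF a.
have s4A a : S (fun p => 4%:R * A a p).
  exact: (der_mulS hD (der_cstS hD _) (sA a)).
have Spsi : S psi by exact: (riemann_S hF).
have D4A c a : D c (fun p => 4%:R * A a p) q = 4%:R * D c (A a) q.
  by rewrite (der_mul hD _ (der_cstS hD _) (sA a) Uq) (der_cst hD) // mul0r add0r.
have D14 : D i1 (D i4 psi) q = (D i1 (B i4) q - 4%:R * D i1 (A i2) q) * psi q
    + (B i4 q - 4%:R * A i2 q) * D i1 psi q.
  rewrite (der_congr hD _ integrable_D4psi Uq).
  rewrite (der_mul hD _ (der_subS hD (sB i4) (s4A i2)) Spsi Uq).
  by rewrite (der_sub hD _ (sB i4) (s4A i2) Uq) D4A.
have D41 : D i4 (D i1 psi) q = (D i4 (B i1) q + 4%:R * D i4 (A i3) q) * psi q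
    + (B i1 q + 4%:R * A i3 q) * D i4 psi q.
  rewrite (der_congr hD _ integrable_D1psi Uq).
  rewrite (der_mul hD _ (der_addS hD (sB i1) (s4A i3)) Spsi Uq).
  by rewrite (der_add hD _ (sB i1) (s4A i3) Uq) D4A.
have comm := fc_comm hF Spsi i1 i4 Uq.
have E12 := sdF_structure hF i1 i2 Uq.
have E34 := sdF_structure hF i3 i4 Uq.
have E14 := sdG_structure hF i1 i4 Uq.
rewrite /extd !(Fvals Uq) !(der0 hF _ A1 Uq) !(der0 hF _ A4 Uq) in E12 E34 E14.
rewrite D14 D41 !sum4 (integrable_D1psi Uq) (integrable_D4psi Uq) in comm.
rewrite !sum4 !(Fvals Uq) in E12 E34 E14.
(* The factor is $2+4+4$: by the structure equations $D_1B_4-D_4B_1$, $-4D_1A_2$ and $-4D_4A_3$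
   contribute $2\psi$, $4\psi$ and $4\psi$, and the connection terms cancel against the
   commutator. *)
suff /eqP : 10%:R * (psi q * psi q) = 0.
  by rewrite mulf_eq0 mulf_eq0 orbb pnatr_eq0 /= => /eqP.
have [a1 a4] := (A1 Uq, A4 Uq).
pose Z := psi q.
have d12 : D i1 (A i2) q = - Z - (0 - \sum_(f < 4) T f i1 i2 q * A f q
     + (0 * B i2 q - A i2 q * B i1 q)).
  apply: (eq_lincomb (k := -1) E12); rewrite sum4 !(Fvals Uq) /Z; ring.
have d43 : D i4 (A i3) q = - Z - \sum_(f < 4) T f i3 i4 q * A f q
     + (A i3 q * B i4 q - 0 * B i3 q).
  apply: (eq_lincomb (k := 1) E34); rewrite sum4 !(Fvals Uq) /Z; ring.
have d14 : D i1 (B i4) q = D i4 (B i1) q + 2%:R * Z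
     + \sum_(f < 4) T f i1 i4 q * B f q.
  apply: (eq_lincomb (k := -1) E14); rewrite sum4 /Z; ring.
move: comm; rewrite d12 d43 d14 => /(eq_lincomb (k := 1)); apply.
rewrite /Z !sum4 !(Fvals Uq).
rewrite /sdA /sdB in a1 a4 *.
rewrite !TE /dual /= !(G_norm hF Uq) a1 a4; ring.
Qed.

End Integrable.

(** * Algebraic consequences of the Bianchi identities in the Einstein case *)

Section Einstein.
Variable L : K.
Hypotheses (F13 : forall q, U q -> F i1 i3 q = 0).
Hypotheses (F24 : forall q, U q -> F i2 i4 q = 0).
Hypotheses (F14 : forall q, U q -> F i1 i4 q = 0).
Hypotheses (F12 : forall q, U q -> F i1 i2 q = 0).
Hypotheses (F34 : forall q, U q -> F i3 i4 q = 0).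
Hypotheses (G13 : forall q, U q -> Gc i1 i3 q = 0).
Hypotheses (G24 : forall q, U q -> Gc i2 i4 q = 0).
Hypotheses (G12 : forall q, U q -> Gc i1 i2 q = - Gc i3 i4 q).
Hypotheses (G34 : forall q, U q -> Gc i3 i4 q = 2%:R * F i2 i3 q - L).

Let Fvals q (Uq : U q) :
  ((F i1 i4 q = 0) * (F i4 i1 q = 0) * (F i1 i3 q = 0) * (F i3 i1 q = 0)
  * (F i2 i4 q = 0) * (F i4 i2 q = 0) * (F i1 i2 q = 0)
  * (F i2 i1 q = 0) * (F i3 i4 q = 0) * (F i4 i3 q = 0)
  * (F i3 i2 q = - F i2 i3 q) * (F i1 i1 q = 0) * (F i2 i2 q = 0)
  * (F i3 i3 q = 0) * (F i4 i4 q = 0) * (Gc i1 i4 q = 0)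
  * (Gc i4 i1 q = 0) * (Gc i1 i3 q = 0) * (Gc i3 i1 q = 0)
  * (Gc i2 i4 q = 0) * (Gc i4 i2 q = 0)
  * (Gc i1 i1 q = 0) * (Gc i2 i2 q = 0) * (Gc i3 i3 q = 0) * (Gc i4 i4 q = 0)
  * (Gc i3 i4 q = (2%:R * F i2 i3 q - L)%R)
  * (Gc i4 i3 q = (L - 2%:R * F i2 i3 q)%R)
  * (Gc i1 i2 q = (L - 2%:R * F i2 i3 q)%R)
  * (Gc i2 i1 q = (2%:R * F i2 i3 q - L)%R) * (Gc i3 i2 q = - Gc i2 i3 q))%type.
Proof.
have d c := @anti0 F c q sdF_anti.
have dG c := @anti0 Gc c q sdG_anti.
have g : Gc i1 i4 q = 0 by rewrite sdG14 // F34 // F12 // subrr.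
do !split; rewrite ?d ?dG ?g //;
  rewrite ?(sdF_anti i1 i4) ?(sdF_anti i1 i3) ?(sdF_anti i2 i4)
    ?(sdF_anti i1 i2) ?(sdF_anti i3 i4) ?(sdF_anti i2 i3)
    ?(sdG_anti i1 i4) ?(sdG_anti i1 i3) ?(sdG_anti i2 i4)
    ?(sdG_anti i1 i2) ?(sdG_anti i3 i4) ?(sdG_anti i2 i3)
    ?G13 ?G24 ?G12 ?G34 ?F12 ?F13 ?F14 ?F24 ?F34 ?g ?oppr0 ?opprK ?opprB //.
Qed.

Let D0 c k l q : (forall p, U p -> F k l p = 0) -> U q -> D c (F k l) q = 0.
Proof. exact: (der0 hF). Qed.

(** Every differentiated component vanishes identically, so the Bianchi identity is algebraic. The
    factor $3F_{23}-L$ is $3\Psi_2$, as each Schouten term of $\Psi_2$ equals $L/6$. *)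
Lemma einstein_A4_F23 q : U q -> A i4 q * (3%:R * F i2 i3 q - L) = 0.
Proof.
move=> Uq; have := bianchi_sdF hF i1 i2 i4 Uq; rewrite /cyc.
rewrite !D0 //; try by move=> p Up; rewrite Fvals.
rewrite !sum4 !(Fvals Uq) => /(eq_lincomb (k := -1)); apply.
rewrite /sdA /sdB /sdC !TE /dual /= !(G_norm hF Uq); ring.
Qed.

Lemma einstein_A1_F23 q : U q -> A i1 q * (3%:R * F i2 i3 q - L) = 0.
Proof.
move=> Uq; have := bianchi_sdF hF i1 i3 i4 Uq; rewrite /cyc.
rewrite !D0 //; try by move=> p Up; rewrite Fvals.
rewrite !sum4 !(Fvals Uq) => /(eq_lincomb (k := 1)); apply.
rewrite /sdA /sdB /sdC !TE /dual /= !(G_norm hF Uq); ring.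
Qed.

Hypothesis F23 : forall q, U q -> 3%:R * F i2 i3 q = L.

Let n3 : 3%:R != 0 :> K. Proof. by rewrite pnatr_eq0. Qed.

Let F23E q : U q -> F i2 i3 q = 3%:R^-1 * L.
Proof. by move=> Uq; apply: (mulfI n3); rewrite F23 // mulVKf. Qed.

(** With $\Psi_2=0$ on all of [U], $F_{23}$ is the constant $L/3$ and its derivative drops out. By
    the Ricci equations $G_{23}=-2\Psi_3$. *)
Lemma einstein_A4_G23 q : U q -> A i4 q * Gc i2 i3 q = 0.
Proof.
move=> Uq; have := bianchi_sdF hF i2 i3 i4 Uq; rewrite /cyc.
rewrite (der0 hF _ F23E Uq).
rewrite !D0 //; try by move=> p Up; rewrite Fvals.
rewrite !sum4 !(Fvals Uq) -(F23 Uq) => /(eq_lincomb (k := 1)); apply.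
rewrite /sdA /sdB /sdC !TE /dual /= !(G_norm hF Uq); ring.
Qed.

Lemma einstein_A1_G23 q : U q -> A i1 q * Gc i2 i3 q = 0.
Proof.
move=> Uq; have := bianchi_sdF hF i1 i2 i3 Uq; rewrite /cyc.
rewrite (der0 hF _ F23E Uq).
rewrite !D0 //; try by move=> p Up; rewrite Fvals.
rewrite !sum4 !(Fvals Uq) -(F23 Uq) => /(eq_lincomb (k := 1)); apply.
rewrite /sdA /sdB /sdC !TE /dual /= !(G_norm hF Uq); ring.
Qed.

Hypothesis G23 : forall q, U q -> Gc i2 i3 q = 0.
Hypotheses (H12 : forall q, U q -> H i1 i2 q = 0).
Hypotheses (H34 : forall q, U q -> H i3 i4 q = 0).
Hypotheses (H13 : forall q, U q -> H i1 i3 q = 0).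
Hypotheses (H24 : forall q, U q -> H i2 i4 q = 0).

Let H14 q : U q -> H i1 i4 q = F i2 i3 q.
Proof. by move=> Uq; rewrite /sdH (riemann_pair hF). Qed.

Let Hvals q (Uq : U q) :
  ((H i1 i2 q = 0) * (H i3 i4 q = 0) * (H i4 i2 q = 0) * (H i2 i4 q = 0)
   * (H i3 i1 q = 0))%type.
Proof.
do !split; rewrite ?H12 ?H34 ?H24 //.
  by rewrite sdH_anti H24 ?oppr0.
by rewrite sdH_anti H13 ?oppr0.
Qed.

(** The value is $2L/3-L$, a constant; it removes a derivative from the Bianchi identity for
    [sdG]. *)
Let Gc34 q : U q -> Gc i3 i4 q = - (3%:R^-1 * L).
Proof.
move=> Uq; rewrite G34 // F23E //.
by apply: (mulfI n3); rewrite mulrBr mulrN mulrCA !mulVKf //; ring.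
Qed.

Let Gc12 q : U q -> Gc i1 i2 q = 3%:R^-1 * L.
Proof. by move=> Uq; rewrite G12 // Gc34 // opprK. Qed.

Let DG c k l k0 q : (forall p, U p -> Gc k l p = k0) -> U q -> D c (Gc k l) q = 0.
Proof. exact: (der0 hF). Qed.

(** The Bianchi identity for [sdG] brings in [sdH]. All components of [sdG] are constant by now, and
    on $(e_2,e_3,e_4)$ only $2A_4H_{23}$ remains, where $H_{23}=\Psi_4$. *)
Lemma einstein_A4_H23 q : U q -> A i4 q * H i2 i3 q = 0.
Proof.
move=> Uq; apply: (mulfI (_ : 2%:R != 0 :> K)); first by rewrite pnatr_eq0.
rewrite mulr0; have := bianchi_sdG hF i2 i3 i4 Uq; rewrite /cyc.
rewrite (DG _ Gc34 Uq) (DG _ G23 Uq) (@DG _ i4 i2 0) //; last first.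
  by move=> p Up; rewrite Fvals.
rewrite !sum4 !(Fvals Uq) !(Hvals Uq) G23 // -(F23 Uq).
move=> /(eq_lincomb (k := 1)); apply.
rewrite /sdA /sdB /sdC !TE /dual /= !(G_norm hF Uq); ring.
Qed.

Lemma einstein_A1_H23 q : U q -> A i1 q * H i2 i3 q = 0.
Proof.
move=> Uq; apply: (mulfI (_ : 2%:R != 0 :> K)); first by rewrite pnatr_eq0.
rewrite mulr0; have := bianchi_sdG hF i1 i2 i3 Uq; rewrite /cyc.
rewrite (DG _ Gc12 Uq) (DG _ G23 Uq) (@DG _ i3 i1 0) //; last first.
  by move=> p Up; rewrite Fvals.
rewrite !sum4 !(Fvals Uq) !(Hvals Uq) G23 // -(F23 Uq).
move=> /(eq_lincomb (k := 1)); apply.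
rewrite /sdA /sdB /sdC !TE /dual /= !(G_norm hF Uq); ring.
Qed.

End Einstein.
End SelfdualPlane.

(** * Ricci curvature *)

Section Ricci.
Variables (K : numFieldType) (M : Type) (U : M -> Prop).
Variables (S : (M -> K) -> Prop) (D : 'I_4 -> (M -> K) -> M -> K).
Variables (T G : 'I_4 -> 'I_4 -> 'I_4 -> M -> K).
Hypothesis hF : frame_calculus U S D T G.
Local Notation R := (riemann D T G).
Local Notation A := (sdA G).
Local Notation F := (sdF D T G).
Local Notation Gc := (sdG D T G).
Local Notation H := (sdH D T G).

Definition ricci a b q := \sum_(c < 4) R (dual c) a c b q.

Lemma riemann_diagr a b c q : R a b c c q = 0.
Proof. exact: (anti0 (w := R a b) _ _ (riemann_antir hF a b)). Qed.

Lemma riemann_diagl a c d q : U q -> R a a c d q = 0.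
Proof. by move=> Uq; rewrite (riemann_pair hF) // riemann_diagr. Qed.

(** With [riemann_normr] and [riemann_normp], these rules reduce all components to the 21 given by
    ordered index pairs. The Ricci formulas below then follow by [ring]; only [ricci34] also uses
    the cyclic identity. *)
Definition riemann_norml q (Uq : U q) :=
  (fun c d => riemann_diagl i1 c d Uq, fun c d => riemann_diagl i2 c d Uq,
   fun c d => riemann_diagl i3 c d Uq, fun c d => riemann_diagl i4 c d Uq,
   fun c d => riemann_antil hF i1 i2 c d Uq,
   fun c d => riemann_antil hF i1 i3 c d Uq,
   fun c d => riemann_antil hF i1 i4 c d Uq,
   fun c d => riemann_antil hF i2 i3 c d Uq,
   fun c d => riemann_antil hF i2 i4 c d Uq,
   fun c d => riemann_antil hF i3 i4 c d Uq).

Definition riemann_normr q :=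
  (fun a b => riemann_diagr a b i1 q, fun a b => riemann_diagr a b i2 q,
   fun a b => riemann_diagr a b i3 q, fun a b => riemann_diagr a b i4 q,
   fun a b => riemann_antir hF a b i1 i2 q,
   fun a b => riemann_antir hF a b i1 i3 q,
   fun a b => riemann_antir hF a b i1 i4 q,
   fun a b => riemann_antir hF a b i2 i3 q,
   fun a b => riemann_antir hF a b i2 i4 q,
   fun a b => riemann_antir hF a b i3 i4 q).

Definition riemann_normp q (Uq : U q) :=
  (riemann_pair hF i1 i3 i1 i2 Uq, riemann_pair hF i1 i4 i1 i2 Uq,
   riemann_pair hF i2 i3 i1 i2 Uq, riemann_pair hF i2 i4 i1 i2 Uq,
   riemann_pair hF i3 i4 i1 i2 Uq, riemann_pair hF i1 i4 i1 i3 Uq,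
   riemann_pair hF i2 i3 i1 i3 Uq, riemann_pair hF i2 i4 i1 i3 Uq,
   riemann_pair hF i3 i4 i1 i3 Uq, riemann_pair hF i2 i3 i1 i4 Uq,
   riemann_pair hF i2 i4 i1 i4 Uq, riemann_pair hF i3 i4 i1 i4 Uq,
   riemann_pair hF i2 i4 i2 i3 Uq, riemann_pair hF i3 i4 i2 i3 Uq,
   riemann_pair hF i3 i4 i2 i4 Uq).

Ltac ricci_norm Uq := rewrite /ricci ?sum4 /sdF /sdG /sdH /dual /=
  !(riemann_norml Uq) ?riemann_normr ?(riemann_normp Uq); ring.

Lemma ricci11 q : U q -> ricci i1 i1 q = 2%:R * F i1 i3 q.
Proof. by move=> Uq; ricci_norm Uq. Qed.

Lemma ricci44 q : U q -> ricci i4 i4 q = 2%:R * F i2 i4 q.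
Proof. by move=> Uq; ricci_norm Uq. Qed.

Lemma ricci14 q : U q -> ricci i1 i4 q = - (F i1 i2 q + F i3 i4 q).
Proof. by move=> Uq; ricci_norm Uq. Qed.

Lemma ricci41 q : U q -> ricci i4 i1 q = ricci i1 i4 q.
Proof. by move=> Uq; ricci_norm Uq. Qed.

Lemma ricci13 q : U q -> ricci i1 i3 q = Gc i1 i3 q.
Proof. by move=> Uq; ricci_norm Uq. Qed.

Lemma ricci24 q : U q -> ricci i2 i4 q = - Gc i2 i4 q.
Proof. by move=> Uq; ricci_norm Uq. Qed.

Lemma ricci12_34 q : U q ->
  ricci i1 i2 q - ricci i3 i4 q = Gc i1 i2 q + Gc i3 i4 q.
Proof. by move=> Uq; ricci_norm Uq. Qed.

Lemma ricci34 q : U q -> ricci i3 i4 q = 2%:R * F i2 i3 q - Gc i3 i4 q.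
Proof.
move=> Uq; have := riemann_cyclic hF i1 i2 i3 i4 Uq.
by move=> /(eq_lincomb (k := -1)); apply; ricci_norm Uq.
Qed.

Lemma ricci33 q : U q -> ricci i3 i3 q = 2%:R * H i1 i3 q.
Proof. by move=> Uq; ricci_norm Uq. Qed.

Lemma ricci22 q : U q -> ricci i2 i2 q = 2%:R * H i2 i4 q.
Proof. by move=> Uq; ricci_norm Uq. Qed.

Lemma ricci23_G q : U q -> ricci i2 i3 q = Gc i2 i3 q + 2%:R * H i1 i2 q.
Proof. by move=> Uq; ricci_norm Uq. Qed.

Lemma ricci23_H q : U q -> ricci i2 i3 q = H i1 i2 q + H i3 i4 q.
Proof. by move=> Uq; ricci_norm Uq. Qed.

Let n2 : 2%:R != 0 :> K. Proof. by rewrite pnatr_eq0. Qed.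

(** The Ricci components along the span of $e_1,e_4$ are $2F_{13}$, $2F_{24}$ and
    $-(F_{12}+F_{34})$, which supplies the hypotheses of [integrable_F34]. *)
Theorem integrable_sd_weyl :
  (forall q, U q ->
    [/\ ricci i1 i1 q = 0, ricci i1 i4 q = 0 & ricci i4 i4 q = 0]) ->
  (forall q, U q -> A i4 q = 0 /\ A i1 q = 0) ->
  forall q, U q -> F i1 i4 q = 0 /\ F i3 i4 q = 0.
Proof.
move=> ric0 kap q Uq.
have A1 p : U p -> A i1 p = 0 by move=> /kap[].
have A4 p : U p -> A i4 p = 0 by move=> /kap[].
split; first exact: (integrable_F14 hF).
apply: (integrable_F34 hF A1 A4 _ _ _ Uq) => p Up; have [r11 r14 r44] := ric0 p Up.
- by apply: (mulfI n2); rewrite -ricci11 // r11 mulr0.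
- by apply: (mulfI n2); rewrite -ricci44 // r44 mulr0.
- apply/eqP; rewrite -subr_eq0 opprK -oppr_eq0; apply/eqP.
  by rewrite -ricci14.
Qed.

(** One coefficient $A_i$ is nonzero on all of [U], so each factor it multiplies vanishes
    identically there and not just at one point. This matters because the next Bianchi identity
    differentiates that factor. *)
Theorem einstein_sd_weyl (L : K) (i : 'I_4) :
  (forall q, U q -> forall a c, ricci a c q = L * (c == dual a)%:R) ->
  (forall q, U q -> F i1 i4 q = 0 /\ F i3 i4 q = 0) ->
  i = i1 \/ i = i4 -> (forall q, U q -> A i q != 0) ->
  forall q, U q -> [/\ 3%:R * F i2 i3 q = L, H i1 i2 q = 0 & H i2 i3 q = 0].
Proof.
move=> ric F0 hi Ai.
have r0 q a c : U q -> (c == dual a) = false -> ricci a c q = 0.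
  by move=> Uq ca; rewrite ric // ca mulr0.
have F14 q : U q -> F i1 i4 q = 0 by move=> /F0[].
have F34 q : U q -> F i3 i4 q = 0 by move=> /F0[].
have F13 q : U q -> F i1 i3 q = 0.
  by move=> Uq; apply: (mulfI n2); rewrite -ricci11 // r0 // mulr0.
have F24 q : U q -> F i2 i4 q = 0.
  by move=> Uq; apply: (mulfI n2); rewrite -ricci44 // r0 // mulr0.
have F12 q : U q -> F i1 i2 q = 0.
  move=> Uq; have /eqP := ricci14 Uq.
  by rewrite r0 // F34 // addr0 eq_sym oppr_eq0 => /eqP.
have G13 q : U q -> Gc i1 i3 q = 0 by move=> Uq; rewrite -ricci13 // r0.
have G24 q : U q -> Gc i2 i4 q = 0.
  by move=> Uq; apply: oppr_inj; rewrite -ricci24 // r0 // oppr0.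
have G12 q : U q -> Gc i1 i2 q = - Gc i3 i4 q.
  move=> Uq; apply/eqP; rewrite -addr_eq0 -ricci12_34 //.
  by rewrite !ric // subrr.
have G34 q : U q -> Gc i3 i4 q = 2%:R * F i2 i3 q - L.
  move=> Uq; have := ricci34 Uq; rewrite ric // eqxx mulr1 => ->.
  by rewrite opprB addrC subrK.
have zero q x : U q -> A i q * x = 0 -> x = 0.
  by move=> Uq /eqP; rewrite mulf_eq0 (negbTE (Ai q Uq)) => /eqP.
have F23 q : U q -> 3%:R * F i2 i3 q = L.
  move=> Uq; apply/eqP; rewrite -subr_eq0; apply/eqP/(zero q _ Uq).
  by case: hi => ->; [apply: (einstein_A1_F23 hF) | apply: (einstein_A4_F23 hF)].
have G23 q : U q -> Gc i2 i3 q = 0.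
  move=> Uq; apply: (zero q _ Uq).
  by case: hi => ->;
    [apply: (einstein_A1_G23 hF F13 F24 F14 F12 F34 G13 G24 G12 G34)
    |apply: (einstein_A4_G23 hF F13 F24 F14 F12 F34 G13 G24 G12 G34)].
have H12 q : U q -> H i1 i2 q = 0.
  move=> Uq; have := ricci23_G Uq; rewrite r0 // G23 // add0r => /esym/eqP.
  by rewrite mulf_eq0 (negbTE n2) => /eqP.
have H34 q : U q -> H i3 i4 q = 0.
  by move=> Uq; have := ricci23_H Uq; rewrite r0 // H12 // add0r.
have H13 q : U q -> H i1 i3 q = 0.
  by move=> Uq; apply: (mulfI n2); rewrite -ricci33 // r0 // mulr0.
have H24 q : U q -> H i2 i4 q = 0.
  by move=> Uq; apply: (mulfI n2); rewrite -ricci22 // r0 // mulr0.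
move=> q Uq; split; [exact: F23 | exact: H12 | apply: (zero q _ Uq)].
by case: hi => ->;
  [apply: (einstein_A1_H23 hF F13 F24 F14 F12 F34 G13 G24 G12 G34)
  |apply: (einstein_A4_H23 hF F13 F24 F14 F12 F34 G13 G24 G12 G34)].
Qed.

End Ricci.

(** * The Levi-Civita connection in a null frame *)

Section Frame.
Variables (R : realType) (b : ground) (M : manifold4 R b).
Variables (g : M -> 'M[Cplx R]_4) (nabla : vfield M -> vfield M -> vfield M).
Variables (U : set M) (e : 'I_4 -> vfield M).
Hypotheses (hg : is_metric g) (hnabla : is_levi_civita g nabla).
Hypotheses (hU : open U) (he : null_frame g U e).
Local Notation C := (Cplx R).
Local Notation D c := (act (e c)).

(** * Pointwise expansion in the null frame *)

Definition ipv (q : M) (u v : 'rV[C]_4) : C := (u *m g q *m v^T) 0 0.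

Lemma ipvDl q u u' v : ipv q (u + u') v = ipv q u v + ipv q u' v.
Proof. by rewrite /ipv !mulmxDl mxE. Qed.

Lemma ipvDr q u v v' : ipv q u (v + v') = ipv q u v + ipv q u v'.
Proof. by rewrite /ipv linearD mulmxDr mxE. Qed.

Lemma ipvZl q x u v : ipv q (x *: u) v = x * ipv q u v.
Proof. by rewrite /ipv -!scalemxAl mxE. Qed.

Lemma ipvZr q x u v : ipv q u (x *: v) = x * ipv q u v.
Proof. by rewrite /ipv linearZ -scalemxAr mxE. Qed.

Lemma ipvNr q u v : ipv q u (- v) = - ipv q u v.
Proof. by rewrite -scaleN1r ipvZr mulN1r. Qed.

Lemma ipvC q u v : ipv q u v = ipv q v u.
Proof.
transitivity ((u *m g q *m v^T)^T 0 0); first by rewrite [RHS]mxE.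
by rewrite trmx_mul trmx_mul trmxK (Defs.metric_sym hg) mulmxA.
Qed.

Lemma frame_smooth a : smooth_field U (e a).
Proof. by have [+ _] := he; apply. Qed.

Lemma frame_ip q a c : U q -> ipv q (e a q) (e c q) = (c == dual a)%:R.
Proof.
move=> Uq; have [_ /(_ q Uq a c)] := he; rewrite /ip -/(ipv _ _ _) => ->.
by congr (_%:R); move: a c; do 2!elim/ord4_ind.
Qed.

Definition frame_mx q : 'M[C]_4 := \matrix_(c < 4) e c q.

(** The Gram matrix of the frame is the matrix of the involution [dual]. It squares to the identity,
    so it is invertible, and so is its factor [frame_mx q]. *)
Lemma frame_mx_unit q : U q -> frame_mx q \in unitmx.
Proof.
move=> Uq.
have E : frame_mx q *m (g q *m (frame_mx q)^T) = \matrix_(a, c) (c == dual a)%:R.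
  apply/matrixP => a c; rewrite [RHS]mxE -(frame_ip a c Uq) /ipv mulmxA.
  rewrite [LHS]mxE [RHS]mxE.
  apply: eq_bigr => i _; rewrite !mxE; congr (_ * _).
  by apply: eq_bigr => j _; rewrite !mxE.
have NN : \matrix_(a < 4, c < 4) (c == dual a)%:R
    *m \matrix_(a < 4, c < 4) (c == dual a)%:R = 1%:M :> 'M[C]_4.
  apply/matrixP => a c; rewrite !mxE (bigD1 (dual a)) //= !mxE eqxx mul1r.
  rewrite big1 ?addr0 => [|i /negbTE ni]; last by rewrite !mxE ni mul0r.
  by rewrite dualK eq_sym.
have := mulmx1_unit NN => -[uN _].
by move: uN; rewrite -E unitmx_mul => /andP[].
Qed.

Lemma frame_coord q (w : 'rV[C]_4) a : U q ->
  ipv q (e a q) (w *m frame_mx q) = w 0 (dual a).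
Proof.
move=> Uq; rewrite mulmx_sum_row sum4 !ipvDr !ipvZr !rowK !frame_ip //.
by move: a; elim/ord4_ind; rewrite /dual /= ?mulr1 ?mulr0 ?addr0 ?add0r.
Qed.

Lemma coframeE q a v : U q -> coframe e a q v = ipv q (e (dual a) q) v.
Proof.
move=> Uq; rewrite -[in RHS](mulmxKV (frame_mx_unit Uq) v) frame_coord //.
by rewrite dualK.
Qed.

Lemma frame_expand q v : U q -> v = \sum_(f < 4) ipv q (e (dual f) q) v *: e f q.
Proof.
move=> Uq; rewrite -[LHS](mulmxKV (frame_mx_unit Uq) v) mulmx_sum_row.
by apply: eq_bigr => f _; rewrite rowK -coframeE.
Qed.

Lemma ipv_expand q u v : U q -> 
  ipv q u v = \sum_(f < 4) ipv q (e (dual f) q) u * ipv q (e f q) v.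
Proof.
by move=> Uq; rewrite {1}(frame_expand u Uq) !sum4 !ipvDl !ipvZl.
Qed.

Lemma frame_indep q (w : 'I_4 -> C) : U q ->
  \sum_(f < 4) w f *: e f q = 0 -> forall f, w f = 0.
Proof.
move=> Uq w0 f; have: ipv q (e (dual f) q) (\sum_(f < 4) w f *: e f q) = 0.
  by rewrite w0 /ipv linear0 mulmx0 mxE.
rewrite sum4 !ipvDr !ipvZr !frame_ip //.
by move: f; elim/ord4_ind; rewrite /dual /= ?mulr1 ?mulr0 ?addr0 ?add0r.
Qed.

(** $\Gamma_{acd}$ as a product of vector fields, from which smoothness and antisymmetry are
    immediate; [Gamma_frame] identifies it with [Gamma]. The coefficients [struct_coef] come from
    the torsion-free condition, and [lie_bracket_frame] shows that they expand the brackets. *)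
Definition conn a c d : M -> C := ip g (e a) (nabla (e d) (e c)).
Definition struct_coef f c d : M -> C := fun q =>
  conn (dual f) d c q - conn (dual f) c d q.

Lemma nabla_frame_smooth c d : smooth_field U (nabla (e d) (e c)).
Proof. exact: (nabla_smooth hnabla hU (@frame_smooth d) (@frame_smooth c)). Qed.

Lemma conn_smooth a c d : smooth U (conn a c d).
Proof.
exact: (metric_smooth hg hU (@frame_smooth a) (@nabla_frame_smooth c d)).
Qed.

Lemma struct_coef_smooth f c d : smooth U (struct_coef f c d).
Proof. exact: (smoothB hU (@conn_smooth _ _ _) (@conn_smooth _ _ _)). Qed.

Lemma conn_anti a c d q : U q -> conn a c d q = - conn c a d q.
Proof.
move=> Uq; have := nabla_metric hnabla hU (@frame_smooth d)
  (@frame_smooth a) (@frame_smooth c) Uq.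
rewrite (act_congr (h := fun=> (c == dual a)%:R) _ hU Uq); last first.
  by move=> p Up; rewrite -(frame_ip a c Up).
rewrite act_cst /ip -!/(ipv _ _ _) ipvC => /esym/eqP.
by rewrite addrC addr_eq0 => /eqP.
Qed.

Lemma act_expand (X : vfield M) f q (w : 'I_4 -> C) :
  X q = \sum_(j < 4) w j *: e j q -> act X f q = \sum_(j < 4) w j * D j f q.
Proof.
move=> Xq; under eq_bigr do rewrite mulr_sumr.
rewrite exchange_big; apply: eq_bigr => mu _ /=.
rewrite Xq summxE mulr_suml; apply: eq_bigr => j _.
by rewrite mxE mulrA.
Qed.

Lemma torsion_expand c d q : U q ->
  nabla (e c) (e d) q - nabla (e d) (e c) q =
  \sum_(f < 4) struct_coef f c d q *: e f q.
Proof.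
move=> Uq; rewrite [LHS](frame_expand _ Uq); apply: eq_bigr => f _.
by rewrite ipvDr ipvNr.
Qed.

(** The set [V] may be smaller than [U] because the lemma is applied to coordinate functions, known
    to be smooth only on a chart domain. *)
Lemma D_comm V f c d q : open V -> V `<=` U -> smooth V f -> V q ->
  D c (D d f) q - D d (D c f) q = \sum_(j < 4) struct_coef j c d q * D j f q.
Proof.
move=> oV VU sf Vq.
rewrite -(nabla_torsion_free hnabla oV (smooth_field_subset VU (@frame_smooth c))
  (smooth_field_subset VU (@frame_smooth d)) sf Vq).
by apply: act_expand; apply: torsion_expand; exact: VU.
Qed.

Lemma lie_bracket_frame c d q : U q ->
  lie_bracket (e c) (e d) q = \sum_(f < 4) struct_coef f c d q *: e f q.
Proof.
move=> Uq; apply/rowP => mu; rewrite lie_bracketE.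
pose V := U `&` chart_dom (chart_at q).
have oV : open V by apply: openI => //; exact: chart_dom_open.
have Vq : V q by split=> //; exact: chart_at_dom.
have sV : smooth V (coordf q mu).
  by apply: smooth_subset (@coordf_smooth _ _ _ q mu); exact: subIsetr.
rewrite (D_comm c d oV (@subIsetl _ _ _) sV Vq) summxE.
by apply: eq_bigr => f _; rewrite act_coordf mxE.
Qed.


Lemma act_derivations V : open V -> V `<=` U ->
  derivations V (smooth V) (fun c => act (e c)).
Proof.
move=> oV VU; split.
- by move=> f h; exact: smoothD.
- by move=> f; exact: smoothN.
- by move=> f h; exact: smoothM.
- move=> c f; exact: (@frame_smooth c V oV VU f).
- by move=> k; exact: smooth_cst.
- by move=> c k q _; exact: act_cst.
- by move=> c f h fh q Vq; exact: (act_congr _ oV Vq fh).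
- by move=> c f h sf sh q Vq; exact: (actD _ sf sh Vq).
- by move=> c f sf q Vq; exact: (actN _ oV sf Vq).
- by move=> c f h sf sh q Vq; exact: (actM _ sf sh Vq).
Qed.

(** Applied to the four coordinates at $q$, the Jacobi identity of derivations gives a vanishing
    combination of frame vectors; independence of the frame kills each coefficient. *)
Lemma struct_coef_jacobi j c d l q : U q ->
  jac (fun c => act (e c)) struct_coef c d l j q +
  jac (fun c => act (e c)) struct_coef d l c j q +
  jac (fun c => act (e c)) struct_coef l c d j q = 0.
Proof.
move=> Uq.
pose V := U `&` chart_dom (chart_at q).
have oV : open V by apply: openI => //; exact: chart_dom_open.
have Vq : V q by split=> //; exact: chart_at_dom.
have VU : V `<=` U by exact: subIsetl.
pose w k := jac (fun c => act (e c)) struct_coef c d l k q +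
  jac (fun c => act (e c)) struct_coef d l c k q +
  jac (fun c => act (e c)) struct_coef l c d k q.
suff w0 : \sum_(k < 4) w k *: e k q = 0 by exact: (frame_indep Uq w0 j).
apply/rowP => mu; rewrite summxE [RHS]mxE.
have sx : smooth V (coordf q mu).
  by apply: smooth_subset (@coordf_smooth _ _ _ q mu); exact: subIsetr.
apply: (etrans _ (jac_cyclic (act_derivations oV VU)
  (fun f c d => smooth_subset VU (@struct_coef_smooth f c d)) c d l Vq sx _)).
  by apply: eq_bigr => k _; rewrite mxE act_coordf.
by move=> y sy a b' p Vp; exact: (D_comm a b' oV VU sy Vp).
Qed.

Lemma levi_civita_frame :
  frame_calculus U (smooth U) (fun c => act (e c)) struct_coef conn.
Proof.
split.
- exact: (act_derivations hU (@subset_refl _ U)).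
- exact: conn_smooth.
- by [].
- exact: conn_anti.
- by move=> f sf c d q Uq; exact: (D_comm c d hU (@subset_refl _ U) sf Uq).
- exact: struct_coef_jacobi.
Qed.

(** * Curvature and Ricci components in the frame *)

Local Notation Rf := (riemann (fun c => act (e c)) struct_coef conn).

(** Differentiating $g(e_a,\nabla_{e_l}e_{b'})$ along $e_k$ gives this term plus
    $g(\nabla_{e_k}e_a,\nabla_{e_l}e_{b'})$, which is expanded in the frame and moved across by
    antisymmetry. *)
Lemma nabla2_frame a b' k l q : U q ->
  ipv q (e a q) (nabla (e k) (nabla (e l) (e b')) q) =
    D k (conn a b' l) q + \sum_(f < 4) conn a (dual f) k q * conn f b' l q.
Proof.
move=> Uq; have := nabla_metric hnabla hU (@frame_smooth k) (@frame_smooth a)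
  (@nabla_frame_smooth b' l) Uq.
rewrite -[ip g (nabla (e k) (e a)) _ q]/(ipv q _ _).
rewrite (ipv_expand (nabla (e k) (e a) q) _ Uq) => E.
apply: (addrI (\sum_(f < 4) conn (dual f) a k q * conn f b' l q)).
apply: (etrans (esym E)); rewrite addrCA -big_split big1 ?addr0 // => f _.
by rewrite /= (conn_anti a _ _ Uq) mulNr addrN.
Qed.

Lemma nabla_bracket_frame a b' c d q : U q ->
  ipv q (e a q) (nabla (lie_bracket (e c) (e d)) (e b') q) =
    \sum_(f < 4) struct_coef f c d q * conn a b' f q.
Proof.
move=> Uq.
have sZ f : smooth_field U (fun p => struct_coef f c d p *: e f p).
  exact: (smooth_fieldZ (@struct_coef_smooth f c d) (@frame_smooth f)).
have s2 := smooth_fieldD (sZ i1) (sZ i2); have s3 := smooth_fieldD s2 (sZ i3).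
have s4 := smooth_fieldD s3 (sZ i4); have sb := @frame_smooth b'.
have E : forall p, U p ->
    struct_coef i1 c d p *: e i1 p + struct_coef i2 c d p *: e i2 p
    + struct_coef i3 c d p *: e i3 p + struct_coef i4 c d p *: e i4 p
    = lie_bracket (e c) (e d) p.
  by move=> p Up; rewrite lie_bracket_frame // sum4.
(* The bracket agrees with its frame expansion only on [U], so locality comes before linearity in
   the direction. *)
rewrite -(nabla_local hnabla hU s4 sb E (fun _ _ => erefl) Uq).
rewrite (nabla_addl hnabla hU s3 (sZ i4) sb Uq).
rewrite (nabla_addl hnabla hU s2 (sZ i3) sb Uq).
rewrite (nabla_addl hnabla hU (sZ i1) (sZ i2) sb Uq).
rewrite !(nabla_scalel hnabla hU (@struct_coef_smooth _ _ _) (@frame_smooth _) sb Uq).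
by rewrite !ipvDr !ipvZr sum4.
Qed.

Lemma curvature_frame a b' c d q : U q ->
  ipv q (e a q) (curvature nabla (e c) (e d) (e b') q) = Rf a b' c d q.
Proof.
move=> Uq; rewrite /curvature !ipvDr !ipvNr !nabla2_frame // nabla_bracket_frame //.
by rewrite /riemann sumrB opprD addrACA.
Qed.

Lemma gmx_frame a c q : U q -> gmx g e q a c = (c == dual a)%:R.
Proof. by move=> Uq; rewrite mxE; exact: frame_ip. Qed.

Lemma sum_gmx a q (w : 'I_4 -> C) : U q ->
  \sum_(d < 4) gmx g e q a d * w d = w (dual a).
Proof.
move=> Uq; rewrite (bigD1 (dual a)) //= gmx_frame // eqxx mul1r big1 ?addr0 //.
by move=> d /negbTE da; rewrite gmx_frame // da mul0r.
Qed.

Lemma Gamma_frame a b' c q : U q -> Gamma g nabla e a b' c q = conn a b' c q.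
Proof.
move=> Uq; apply: (etrans (sum_gmx a (fun f => Gamma_up nabla e f b' c q) Uq)).
apply: (etrans (coframeE _ _ Uq)).
exact: (congr1 (fun k => ipv q (e k q) (nabla (e c) (e b') q)) (dualK a)).
Qed.

Lemma Riem_up_frame a b' c d q : U q ->
  Riem_up nabla e a b' c d q = Rf (dual a) b' c d q.
Proof. by move=> Uq; rewrite /Riem_up coframeE // curvature_frame. Qed.

Lemma Riem_frame a b' c d q : U q -> Riem g nabla e a b' c d q = Rf a b' c d q.
Proof.
move=> Uq; apply: (etrans (sum_gmx a (fun f => Riem_up nabla e f b' c d q) Uq)).
apply: (etrans (Riem_up_frame _ _ _ _ Uq)).
exact: (congr1 (fun k => Rf k b' c d q) (dualK a)).
Qed.

Lemma Ric_frame a c q : U q ->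
  Ric nabla e a c q = ricci (fun c => act (e c)) struct_coef conn a c q.
Proof. by move=> Uq; apply: eq_bigr => k _; rewrite Riem_up_frame. Qed.

End Frame.

(** * Weyl components *)

(** Here [n] is a metric component and [s] the scalar curvature: off the metric pairing, a Schouten
    component is half the Ricci component. *)
Lemma schouten_eq0 (K : numFieldType) (x s n : K) :
  n = 0 -> 2%:R^-1 * x - 12%:R^-1 * s * n = 0 -> x = 0.
Proof.
move=> ->; rewrite mulr0 subr0 => /eqP.
by rewrite mulf_eq0 invr_eq0 pnatr_eq0 /= => /eqP.
Qed.

(** The scalar curvature is $4L$, and $\frac12-\frac4{12}=\frac16$. *)
Lemma schouten_einstein (K : numFieldType) (L n : K) :
  2%:R^-1 * (L * n) - 12%:R^-1 * (L + L + L + L) * n = 6%:R^-1 * L * n.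
Proof. by field. Qed.

Lemma psi2_eq0 (K : numFieldType) (x L : K) : 3%:R * x = L ->
  x - 6%:R^-1 * L * 1 - 6%:R^-1 * L * 1 = 0.
Proof. by move=> <-; field. Qed.

Section WeylComponents.
Variables (R : realType) (b : ground) (M : manifold4 R b).
Variables (g : M -> 'M[Cplx R]_4) (nabla : vfield M -> vfield M -> vfield M).
Variables (U : set M) (e : 'I_4 -> vfield M).
Hypotheses (hg : is_metric g) (hnabla : is_levi_civita g nabla).
Hypotheses (hU : open U) (he : null_frame g U e).
Local Notation C := (Cplx R).
Local Notation Df := (fun c => act (e c)).
Local Notation Tf := (struct_coef g nabla e).
Local Notation Gf := (conn g nabla e).
Local Notation P := (Schouten g nabla e).

Lemma Weyl_frame a b' c d q : U q ->
  Weyl g nabla e a b' c d q = riemann Df Tf Gf a b' c d q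
    + (d == dual a)%:R * P c b' q - (c == dual a)%:R * P d b' q
    + (c == dual b')%:R * P d a q - (d == dual b')%:R * P c a q.
Proof.
move=> Uq; rewrite /Weyl !(gmx_frame he _ _ Uq).
by rewrite (Riem_frame hg hnabla hU he _ _ _ _ Uq).
Qed.

Lemma Schouten_frame a c q : U q ->
  P a c q = 2%:R^-1 * ricci Df Tf Gf a c q
    - 12%:R^-1 * Rscal g nabla e q * (c == dual a)%:R.
Proof.
move=> Uq; rewrite /Schouten (gmx_frame he _ _ Uq).
by rewrite (Ric_frame hg hnabla hU he _ _ Uq).
Qed.

Lemma invmx_gmx q : U q -> invmx (gmx g e q) = gmx g e q.
Proof.
move=> Uq.
have gg : gmx g e q *m gmx g e q = 1%:M.
  apply/matrixP => a c; rewrite [LHS]mxE [RHS]mxE.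
  apply: (etrans (sum_gmx he a (fun k => gmx g e q k c) Uq)).
  by rewrite (gmx_frame he _ _ Uq) dualK eq_sym.
have [u _] := mulmx1_unit gg.
by rewrite -[LHS]mulmx1 -gg mulKmx.
Qed.

Lemma Rscal_einstein L q : einstein_on g nabla e U L -> U q ->
  Rscal g nabla e q = L + L + L + L.
Proof.
move=> ein Uq; have E a : \sum_(c < 4) invmx (gmx g e q) a c * Ric nabla e a c q = L.
  rewrite invmx_gmx //.
  apply: (etrans (sum_gmx he a (fun c => Ric nabla e a c q) Uq)).
  by rewrite ein // (gmx_frame he _ _ Uq) eqxx mulr1.
apply: (etrans (eq_bigr (fun=> L) (fun a _ => E a))); exact: sum4.
Qed.

Lemma ricci_einstein L q a c : einstein_on g nabla e U L -> U q ->
  ricci Df Tf Gf a c q = L * (c == dual a)%:R.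
Proof.
move=> ein Uq; rewrite -(Ric_frame hg hnabla hU he _ _ Uq) ein //.
by rewrite (gmx_frame he _ _ Uq).
Qed.

Lemma Schouten_einstein L q a c : einstein_on g nabla e U L -> U q ->
  P a c q = 6%:R^-1 * L * (c == dual a)%:R.
Proof.
move=> ein Uq; apply: (etrans (Schouten_frame _ _ Uq)).
rewrite (ricci_einstein _ _ ein Uq) (Rscal_einstein ein Uq).
exact: schouten_einstein.
Qed.

(** The metric vanishes on the span of $m$ and $k$, so no Schouten term enters. *)
Lemma Psi0_frame q : U q -> Psi0 g nabla e q = sdF Df Tf Gf i1 i4 q.
Proof.
move=> Uq; apply: (etrans (Weyl_frame _ _ _ _ Uq)).
by rewrite !mul0r !subr0 !addr0.
Qed.

Lemma Psi1_frame q : U q ->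
  Psi1 g nabla e q = sdF Df Tf Gf i3 i4 q + P i4 i1 q.
Proof.
move=> Uq; apply: (etrans (Weyl_frame _ _ _ _ Uq)).
by rewrite !mul0r mul1r !subr0 !addr0 /sdF
  (riemann_pair (levi_civita_frame hg hnabla hU he)).
Qed.

Lemma Psi2_frame q : U q ->
  Psi2 g nabla e q = sdF Df Tf Gf i2 i3 q - P i3 i4 q - P i2 i1 q.
Proof.
move=> Uq; apply: (etrans (Weyl_frame _ _ _ _ Uq)).
by rewrite !mul0r !mul1r !addr0.
Qed.

Lemma Psi3_frame q : U q ->
  Psi3 g nabla e q = sdH Df Tf Gf i1 i2 q - P i2 i3 q.
Proof.
move=> Uq; apply: (etrans (Weyl_frame _ _ _ _ Uq)).
rewrite !mul0r mul1r !subr0 !addr0 /sdH.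
by rewrite (riemann_pair (levi_civita_frame hg hnabla hU he)).
Qed.

Lemma Psi4_frame q : U q -> Psi4 g nabla e q = sdH Df Tf Gf i2 i3 q.
Proof.
move=> Uq; apply: (etrans (Weyl_frame _ _ _ _ Uq)).
by rewrite !mul0r !subr0 !addr0.
Qed.

End WeylComponents.

Lemma open_neq0 (R : realType) (T : topologicalType) (U : set T) (f : T -> Cplx R) :
  open U -> (forall q, U q -> {for q, continuous f}) ->
  open (U `&` [set q | f q != 0]).
Proof.
move=> oU cf; rewrite openE => q [Uq fq].
apply: filterI; first exact: open_nbhs_nbhs.
exact: (cvgr_neq0 _ (cf q Uq) fq).
Qed.

(** * Einstein metrics: localisation where a connection coefficient is nonzero *)

Section Einstein.
Variables (R : realType) (b : ground) (M : manifold4 R b).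
Variables (g : M -> 'M[Cplx R]_4) (nabla : vfield M -> vfield M -> vfield M).
Variable e : 'I_4 -> vfield M.
Hypotheses (hg : is_metric g) (hnabla : is_levi_civita g nabla).

(** Carries [einstein_sd_weyl] over to Weyl components: off-pairing Schouten components vanish, so
    $\Psi_1=F_{34}$, $\Psi_2=F_{23}-L/3$, $\Psi_3=H_{12}$ and $\Psi_4=H_{23}$. *)
Lemma einstein_nonvanishing (W : set M) (L : Cplx R) i q :
  open W -> null_frame g W e -> einstein_on g nabla e W L ->
  (forall q, W q -> Psi0 g nabla e q = 0 /\ Psi1 g nabla e q = 0) ->
  i = i1 \/ i = i4 -> (forall q, W q -> conn g nabla e i1 i4 i q != 0) ->
  W q -> sd_weyl_vanishes_at g nabla e q.
Proof.
move=> oW he ein psi0 hi Ai Wq.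
have P0 a c p : W p -> (c == dual a) = false -> Schouten g nabla e a c p = 0.
  move=> Wp ca; rewrite (Schouten_einstein hg hnabla oW he _ _ ein Wp) ca.
  exact: mulr0.
have [F23 H12 H23] := einstein_sd_weyl (levi_civita_frame hg hnabla oW he)
  (fun p Wp a c => ricci_einstein hg hnabla oW he a c ein Wp)
  (fun p Wp => conj
    (etrans (esym (Psi0_frame hg hnabla oW he Wp)) (proj1 (psi0 p Wp)))
    (etrans (esym (etrans (Psi1_frame hg hnabla oW he Wp)
       (etrans (congr1 _ (P0 i4 i1 p Wp erefl)) (addr0 _)))) (proj2 (psi0 p Wp))))
  hi Ai Wq.
have [psi0q psi1q] := psi0 q Wq; split => //.
- apply: (etrans (Psi2_frame hg hnabla oW he Wq)).
  rewrite !(Schouten_einstein hg hnabla oW he _ _ ein Wq).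
  exact: psi2_eq0.
- apply: (etrans (Psi3_frame hg hnabla oW he Wq)).
  by rewrite H12 P0 // subr0.
- exact: (etrans (Psi4_frame hg hnabla oW he Wq) H23).
Qed.

Lemma einstein_spin_eq0 (U : set M) (L : Cplx R) i :
  open U -> null_frame g U e -> einstein_on g nabla e U L ->
  (forall q, U q -> ~ sd_weyl_vanishes_at g nabla e q) ->
  (forall q, U q -> Psi0 g nabla e q = 0 /\ Psi1 g nabla e q = 0) ->
  i = i1 \/ i = i4 -> forall q, U q -> conn g nabla e i1 i4 i q = 0.
Proof.
move=> oU he ein nv psi0 hi q Uq.
have [//|nz] := eqVneq (conn g nabla e i1 i4 i q) 0.
(* Continuity turns nonvanishing at $q$ into nonvanishing on an open set, to which the frame and all
   hypotheses are restricted. *)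
have oW := open_neq0 oU (fun p Up =>
  smooth_cont (@conn_smooth _ _ _ _ _ _ _ hg hnabla oU he i1 i4 i) Up).
have WU p : (U `&` [set p | conn g nabla e i1 i4 i p != 0]) p -> U p by case.
have heW : null_frame g (U `&` [set p | conn g nabla e i1 i4 i p != 0]) e.
  have [sm pr] := he; split => [a|p /WU]; last exact: pr.
  exact: (smooth_field_subset WU (sm a)).
case: (nv q Uq).
apply: (einstein_nonvanishing oW heW (L := L) _ _ hi).
- by move=> p /WU; exact: ein.
- by move=> p /WU; exact: psi0.
- by move=> p [].
- by split.
Qed.

End Einstein.

Theorem theorem5p10 (R : realType) (b : ground) (M : manifold4 R b)
    (g : M -> 'M[Cplx R]_4) (nabla : vfield M -> vfield M -> vfield M)
    (U : set M) (e : 'I_4 -> vfield M)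
    (hg : is_metric g) (hnabla : is_levi_civita g nabla)
    (hU : open U) (he : null_frame g U e) :
  ((forall q, U q ->
      [/\ Schouten g nabla e i1 i1 q = 0,
          Schouten g nabla e i1 i4 q = 0 &
          Schouten g nabla e i4 i4 q = 0]) ->
   (forall q, U q -> kappa g nabla e q = 0 /\ sigma g nabla e q = 0) ->
   forall q, U q -> Psi0 g nabla e q = 0 /\ Psi1 g nabla e q = 0)
  /\
  (forall Lambda : Cplx R,
   einstein_on g nabla e U Lambda ->
   (forall q, U q -> ~ sd_weyl_vanishes_at g nabla e q) ->
   (forall q, U q -> Psi0 g nabla e q = 0 /\ Psi1 g nabla e q = 0) ->
   forall q, U q -> kappa g nabla e q = 0 /\ sigma g nabla e q = 0).
Proof.
have hF := levi_civita_frame hg hnabla hU he.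
have gam a c d q Uq := @Gamma_frame _ _ _ g nabla U e he a c d q Uq.
split.
  move=> P0 ks q Uq.
  have ric0 a c p (Up : U p) (ca : (c == dual a) = false)
      (Pac : Schouten g nabla e a c p = 0) :
      ricci (fun c => act (e c)) (struct_coef g nabla e) (conn g nabla e) a c p = 0.
    apply: (schouten_eq0 (n := (c == dual a)%:R)
      (s := Rscal g nabla e p)); first by rewrite ca.
    exact: (etrans (esym (Schouten_frame hg hnabla hU he a c Up)) Pac).
  have [F14 F34] := integrable_sd_weyl hF
    (fun p Up => let: And3 P11 P14 P44 := P0 p Up in
      And3 (ric0 i1 i1 p Up erefl P11) (ric0 i1 i4 p Up erefl P14)
           (ric0 i4 i4 p Up erefl P44))
    (fun p Up => conj
      (etrans (esym (gam i1 i4 i4 p Up)) (proj1 (ks p Up)))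
      (etrans (esym (gam i1 i4 i1 p Up)) (proj2 (ks p Up)))) Uq.
  split; first exact: (etrans (Psi0_frame hg hnabla hU he Uq) F14).
  apply: (etrans (Psi1_frame hg hnabla hU he Uq)); rewrite F34 add0r.
  (* The remaining term is $\mathsf P_{41}$, while the hypothesis is on $\mathsf P_{14}$; symmetry
     of the Ricci tensor links them. *)
  have [P11 P14 P44] := P0 q Uq.
  apply: (etrans (Schouten_frame hg hnabla hU he i4 i1 Uq)).
  apply: (etrans _ P14).
  apply: (etrans _ (esym (Schouten_frame hg hnabla hU he i1 i4 Uq))).
  by rewrite (ricci41 hF Uq).
move=> Lambda ein nv psi0 q Uq.
have zero := einstein_spin_eq0 hg hnabla hU he ein nv psi0.
split; apply: (etrans (gam _ _ _ _ Uq)); apply: zero => //; [by right|by left].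
Qed.
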